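(* Let $\mathbb C$ be any pointed protomodular category. If $\mathbb C$ has normalizers, then $\mathbb C$ is B-C facc.
   Context: **Points and protomodularity.** $\mathrm{Pt}\,\mathbb C$ is the category of split epimorphisms with a given splitting $(f,s):X\rightleftarrows Y$, $f s=1_Y$, and commutative squares between them; $\mathrm P_{\mathbb C}:\mathrm{Pt}\,\mathbb C\rightarrow\mathbb C$ is the codomain functor, a fibration whose fibre over $Y$ is denoted $\mathrm{Pt}_Y\mathbb C$; change of base along $g:Y'\rightarrow Y$ is pulling back, $g^*:\mathrm{Pt}_Y\mathbb C\rightarrow\mathrm{Pt}_{Y'}\mathbb C$. A finitely complete category $\mathbb C$ is *protomodular* if all these change of base functors are conservative. Every pointed protomodular category is unital and Mal'tsev, and each fibre $\mathrm{Pt}_Y\mathbb C$ is again pointed protomodular. **Unital categories, commutation and centralizers.** A category $\mathbb D$ is *unital* if it is pointed, finitely complete, and for all $X,Y$ the maps $(1,0):X\rightarrowtail X\times Y$ and $(0,1):Y\rightarrowtail X\times Y$ are jointly strongly epic. In a unital category two maps $a:A\rightarrow Z$, $b:B\rightarrow Z$ *commute* if there is a (necessarily unique) map $\phi:A\times B\rightarrow Z$, the cooperator, with $\phi(1,0)=a$ and $\phi(0,1)=b$. The (earnest) *centralizer* of a monomorphism $v:U\rightarrowtail T$ is a universal map commuting with $v$: a map $\zeta:Z\rightarrow T$ (necessarily a monomorphism) commuting with $v$ through which any map $t:\bar T\rightarrow T$ commuting with $v$ factors uniquely. A unital category is *algebraically cartesian closed* (acc) when the pullback functors along terminal maps between categories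 of points have right adjoints; this is equivalent to any subobject having an earnest centralizer. **B-C facc.** A Mal'tsev category $\mathbb C$ is *fibrewise algebraically cartesian closed* (facc) if every fibre $\mathrm{Pt}_Y\mathbb C$ is algebraically cartesian closed, equivalently every fibre $\mathrm{Pt}_Y\mathbb C$ has centralizers of subobjects. It is *B-C facc* when in addition any change of base functor with respect to the fibration $\mathrm P_{\mathbb C}$ preserves those centralizers. **Normalizers.** For an equivalence relation $(d_0,d_1):R\rightrightarrows X$, a monomorphism $u:U\rightarrowtail X$ is *normal to* $R$ if $u^{-1}(R)=\nabla_U$ (the indiscrete relation $U\times U$) and the induced internal functor $\nabla_U\rightarrow R$ (given by $u$ and $\tilde u:U\times U\rightarrow R$ with $d_i\tilde u=u p_i$) is a discrete fibration, i.e. these squares are pullbacks. A monomorphism $v:U\rightarrowtail T$ *has a normalizer* when there is a pair $(u,R_v)$, with $u:U\rightarrowtail X$ normal to the equivalence relation $R_v$ on $X$, and a map $w:X\rightarrow T$ with $v=w u$, universal in the sense that for every equivalence relation $S$ on an object $X'$, every $u':U\rightarrowtail X'$ normal to $S$ and every $h:X'\rightarrow T$ with $v=h u'$, there is a unique $h':X'\rightarrow X$ with $w h'=h$, $h'u'=u$ and $h'$ underlying a map of equivalence relations $S\rightarrow R_v$. $\mathbb C$ *has normalizers* when every monomorphism has a normalizer. *)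

(* Defs.v *)
From Stdlib Require Import ProofIrrelevance IndefiniteDescription.

Set Implicit Arguments.
Unset Strict Implicit.
Unset Printing Implicit Defensive.

Record Category := {
  Ob :> Type;
  Hom : Ob -> Ob -> Type;
  idm : forall X, Hom X X;
  comp : forall X Y Z, Hom Y Z -> Hom X Y -> Hom X Z;
  comp_idl : forall X Y (f : Hom X Y), comp (idm Y) f = f;
  comp_idr : forall X Y (f : Hom X Y), comp f (idm X) = f;
  comp_assoc : forall W X Y Z (h : Hom Y Z) (g : Hom X Y) (f : Hom W X),
    comp h (comp g f) = comp (comp h g) f
}.

Arguments Hom {c} X Y.
Arguments idm {c} X.
Arguments comp {c X Y Z} g f.

Declare Scope cat_scope.
Delimit Scope cat_scope with cat.
Notation "X ~> Y" := (Hom X Y) (at level 80, right associativity) : cat_scope.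
Notation "g \o f" := (comp g f) (at level 40, left associativity) : cat_scope.
Local Open Scope cat_scope.

Record Functor (C D : Category) := {
  fobj :> C -> D;
  fmap : forall X Y, (X ~> Y) -> (fobj X ~> fobj Y);
  fmap_id : forall X, fmap (idm X) = idm (fobj X);
  fmap_comp : forall X Y Z (g : Y ~> Z) (f : X ~> Y),
    fmap (g \o f) = fmap g \o fmap f
}.

Arguments fmap {C D} f0 {X Y} f.

Record Adjunction (C D : Category) (F : Functor C D) (G : Functor D C) := {
  transpose : forall (X : C) (Y : D), (F X ~> Y) -> (X ~> G Y);
  untranspose : forall (X : C) (Y : D), (X ~> G Y) -> (F X ~> Y);
  transposeK : forall X Y (f : F X ~> Y), untranspose (transpose f) = f;
  untransposeK : forall X Y (g : X ~> G Y), transpose (untranspose g) = g;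
  transpose_natural : forall X X' Y Y' (a : X' ~> X) (f : F X ~> Y) (b : Y ~> Y'),
    transpose (b \o (f \o fmap F a)) = fmap G b \o (transpose f \o a)
}.

Definition has_right_adjoint (C D : Category) (F : Functor C D) : Prop :=
  exists G : Functor D C, inhabited (Adjunction F G).

Section Basics.
Variable C : Category.

Definition monic (X Y : C) (m : X ~> Y) : Prop :=
  forall (T : C) (a b : T ~> X), m \o a = m \o b -> a = b.

Definition iso (X Y : C) (f : X ~> Y) : Prop :=
  exists g : Y ~> X, g \o f = idm X /\ f \o g = idm Y.

Definition terminal (T : C) : Prop := forall X : C, exists! f : X ~> T, True.
Definition initial (T : C) : Prop := forall X : C, exists! f : T ~> X, True.

Definition zero_object (Z : C) : Prop := initial Z /\ terminal Z.
Definition pointed : Prop := exists Z : C, zero_object Z.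

Definition zero_map (X Y : C) (f : X ~> Y) : Prop :=
  exists (Z : C) (a : X ~> Z) (b : Z ~> Y), zero_object Z /\ f = b \o a.

Definition is_product (X Y P : C) (p : P ~> X) (q : P ~> Y) : Prop :=
  forall (T : C) (a : T ~> X) (b : T ~> Y),
    exists! k : T ~> P, p \o k = a /\ q \o k = b.

Definition is_pullback (X Y Z P : C) (f : X ~> Z) (g : Y ~> Z)
    (p : P ~> X) (q : P ~> Y) : Prop :=
  f \o p = g \o q /\
  forall (T : C) (a : T ~> X) (b : T ~> Y), f \o a = g \o b ->
    exists! k : T ~> P, p \o k = a /\ q \o k = b.

Record Span (X Y : C) := {
  apex :> C;
  leg1 : apex ~> X;
  leg2 : apex ~> Y
}.

Definition has_pullbacks : Prop :=
  forall (X Y Z : C) (f : X ~> Z) (g : Y ~> Z),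
    exists P : Span X Y, is_pullback f g (leg1 P) (leg2 P).

(** All finite limits are generated by a terminal object and pullbacks. *)
Record finitely_complete : Prop := {
  fc_terminal : exists T : C, terminal T;
  fc_pullbacks : has_pullbacks
}.

Definition jointly_strongly_epic (A B Z : C) (a : A ~> Z) (b : B ~> Z) : Prop :=
  forall (M D : C) (m : M ~> D) (h : Z ~> D) (a' : A ~> M) (b' : B ~> M),
    monic m -> m \o a' = h \o a -> m \o b' = h \o b ->
    exists d : Z ~> M, m \o d = h.

(** [injections p q i j] says that, for a product with projections [p] and [q],
    [i] and [j] are the maps (1,0) and (0,1). *)
Definition injections (X Y P : C) (p : P ~> X) (q : P ~> Y)
    (i : X ~> P) (j : Y ~> P) : Prop :=
  (p \o i = idm X /\ zero_map (q \o i)) /\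
  (zero_map (p \o j) /\ q \o j = idm Y).

Record unital : Prop := {
  unital_pointed : pointed;
  unital_fc : finitely_complete;
  unital_epic : forall (X Y P : C) (p : P ~> X) (q : P ~> Y) (i : X ~> P) (j : Y ~> P),
    is_product p q -> injections p q i j -> jointly_strongly_epic i j
}.

Definition commute (A B Z : C) (a : A ~> Z) (b : B ~> Z) : Prop :=
  exists (P : C) (p : P ~> A) (q : P ~> B) (i : A ~> P) (j : B ~> P) (phi : P ~> Z),
    is_product p q /\ injections p q i j /\ phi \o i = a /\ phi \o j = b.

Definition is_centralizer (U T Z : C) (v : U ~> T) (zeta : Z ~> T) : Prop :=
  commute zeta v /\
  forall (T' : C) (t : T' ~> T), commute t v -> exists! k : T' ~> Z, zeta \o k = t.

Section Relations.
Variables (X R : C) (d0 d1 : R ~> X).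

(** Relations are handled through generalized elements: the axioms below say
    that [Hom T R] is a (reflexive, equivalence) relation on [Hom T X] for
    every [T]. *)
Definition related (T : C) (x y : T ~> X) : Prop :=
  exists r : T ~> R, d0 \o r = x /\ d1 \o r = y.

Definition relation : Prop :=
  forall (T : C) (r r' : T ~> R), d0 \o r = d0 \o r' -> d1 \o r = d1 \o r' -> r = r'.

Definition reflexive_relation : Prop :=
  relation /\ forall (T : C) (x : T ~> X), related x x.

Definition equivalence_relation : Prop :=
  reflexive_relation /\
  (forall (T : C) (x y : T ~> X), related x y -> related y x) /\
  (forall (T : C) (x y z : T ~> X), related x y -> related y z -> related x z).

End Relations.

Definition relation_map (X' S X R : C) (e0 e1 : S ~> X') (d0 d1 : R ~> X)
    (h : X' ~> X) : Prop :=
  exists k : S ~> R, d0 \o k = h \o e0 /\ d1 \o k = h \o e1.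

(** [(S, e0, e1)], with comparison map [k], is the inverse image of
    [(R, d0, d1)] along [u], i.e. the pullback of [(d0, d1) : R ~> X * X]
    along [u * u]. *)
Definition is_inverse_image (U S X R : C) (d0 d1 : R ~> X) (u : U ~> X)
    (e0 e1 : S ~> U) (k : S ~> R) : Prop :=
  (d0 \o k = u \o e0 /\ d1 \o k = u \o e1) /\
  forall (T : C) (r : T ~> R) (a b : T ~> U), d0 \o r = u \o a -> d1 \o r = u \o b ->
    exists! l : T ~> S, k \o l = r /\ e0 \o l = a /\ e1 \o l = b.

Definition normal_to (U X R : C) (u : U ~> X) (d0 d1 : R ~> X) : Prop :=
  monic u /\
  exists (P : C) (p0 p1 : P ~> U) (u' : P ~> R),
    is_product p0 p1 /\
    is_inverse_image d0 d1 u p0 p1 u' /\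
    is_pullback d0 u u' p0 /\
    is_pullback d1 u u' p1.

Definition is_normalizer (U T X R : C) (v : U ~> T)
    (u : U ~> X) (d0 d1 : R ~> X) (w : X ~> T) : Prop :=
  equivalence_relation d0 d1 /\ normal_to u d0 d1 /\ v = w \o u /\
  forall (X' S : C) (e0 e1 : S ~> X') (u' : U ~> X') (h : X' ~> T),
    equivalence_relation e0 e1 -> normal_to u' e0 e1 -> v = h \o u' ->
    exists! h' : X' ~> X,
      w \o h' = h /\ h' \o u' = u /\ relation_map e0 e1 d0 d1 h'.

Definition has_normalizers : Prop :=
  forall (U T : C) (v : U ~> T), monic v ->
    exists (X R : C) (u : U ~> X) (d0 d1 : R ~> X) (w : X ~> T),
      is_normalizer v u d0 d1 w.

Record maltsev : Prop := {
  maltsev_fc : finitely_complete;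
  maltsev_refl : forall (X R : C) (d0 d1 : R ~> X),
    reflexive_relation d0 d1 -> equivalence_relation d0 d1
}.

End Basics.

Definition conservative (C D : Category) (F : Functor C D) : Prop :=
  forall (X Y : C) (f : X ~> Y), iso (fmap F f) -> iso f.

Definition preserves_centralizers (C D : Category) (F : Functor C D) : Prop :=
  forall (U T Z : C) (v : U ~> T) (zeta : Z ~> T),
    monic v -> is_centralizer v zeta -> is_centralizer (fmap F v) (fmap F zeta).

Section Points.
Variable C : Category.

(** [Pt Y] is the fibre over [Y] of the codomain functor of the category of
    points: morphisms are those lying over [idm Y]. *)
Record PtOb (Y : C) := {
  pt_dom : C;
  pt_map : pt_dom ~> Y;
  pt_sec : Y ~> pt_dom;
  pt_split : pt_map \o pt_sec = idm Y
}.

Record PtHom (Y : C) (A B : PtOb Y) := {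
  pt_hom : pt_dom A ~> pt_dom B;
  pt_hom_map : pt_map B \o pt_hom = pt_map A;
  pt_hom_sec : pt_hom \o pt_sec A = pt_sec B
}.

Lemma PtHom_eq (Y : C) (A B : PtOb Y) (h k : PtHom A B) :
  pt_hom h = pt_hom k -> h = k.
Proof.
destruct h as [h h1 h2], k as [k k1 k2]; simpl; intros <-.
f_equal; apply proof_irrelevance.
Qed.

Definition pt_id (Y : C) (A : PtOb Y) : PtHom A A :=
  Build_PtHom (comp_idr (pt_map A)) (comp_idl (pt_sec A)).

Definition pt_comp (Y : C) (A B D : PtOb Y) (g : PtHom B D) (f : PtHom A B) :
  PtHom A D.
Proof.
refine (@Build_PtHom Y A D (pt_hom g \o pt_hom f) _ _).
- now rewrite comp_assoc, pt_hom_map, pt_hom_map.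
- now rewrite <- comp_assoc, pt_hom_sec, pt_hom_sec.
Defined.

Definition Pt (Y : C) : Category.
Proof.
refine (@Build_Category (PtOb Y) (@PtHom Y) (@pt_id Y) (@pt_comp Y) _ _ _);
  intros; apply PtHom_eq; simpl.
- apply comp_idl.
- apply comp_idr.
- apply comp_assoc.
Defined.

(** [has_pullbacks] is a mere existence statement, so the change of base functor
    is defined with pullbacks obtained by choice. *)
Section ChangeOfBase.
Hypothesis pb : has_pullbacks C.

Definition pullback (X Y Z : C) (f : X ~> Z) (g : Y ~> Z) : Span X Y :=
  proj1_sig (constructive_indefinite_description _ (pb f g)).

Lemma pullbackP (X Y Z : C) (f : X ~> Z) (g : Y ~> Z) :
  is_pullback f g (leg1 (pullback f g)) (leg2 (pullback f g)).
Proof. exact (proj2_sig (constructive_indefinite_description _ (pb f g))). Qed.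

Lemma pullback_sq (X Y Z : C) (f : X ~> Z) (g : Y ~> Z) :
  f \o leg1 (pullback f g) = g \o leg2 (pullback f g).
Proof. exact (proj1 (pullbackP f g)). Qed.

Lemma pullback_ex (X Y Z : C) (f : X ~> Z) (g : Y ~> Z)
    (T : C) (a : T ~> X) (b : T ~> Y) (e : f \o a = g \o b) :
  exists k : T ~> pullback f g,
    leg1 (pullback f g) \o k = a /\ leg2 (pullback f g) \o k = b.
Proof. now destruct (proj2 (pullbackP f g) T a b e) as [k [Hk _]]; exists k. Qed.

Definition pb_pair (X Y Z : C) (f : X ~> Z) (g : Y ~> Z)
    (T : C) (a : T ~> X) (b : T ~> Y) (e : f \o a = g \o b) : T ~> pullback f g :=
  proj1_sig (constructive_indefinite_description _ (pullback_ex e)).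

Lemma pb_pairE (X Y Z : C) (f : X ~> Z) (g : Y ~> Z)
    (T : C) (a : T ~> X) (b : T ~> Y) (e : f \o a = g \o b) :
  leg1 (pullback f g) \o pb_pair e = a /\ leg2 (pullback f g) \o pb_pair e = b.
Proof.
exact (proj2_sig (constructive_indefinite_description _ (pullback_ex e))).
Qed.

Lemma pullback_eq (X Y Z : C) (f : X ~> Z) (g : Y ~> Z)
    (T : C) (k l : T ~> pullback f g) :
  leg1 (pullback f g) \o k = leg1 (pullback f g) \o l ->
  leg2 (pullback f g) \o k = leg2 (pullback f g) \o l -> k = l.
Proof.
intros H1 H2.
assert (e : f \o (leg1 (pullback f g) \o l) = g \o (leg2 (pullback f g) \o l))
  by now rewrite !comp_assoc, pullback_sq.
destruct (proj2 (pullbackP f g) T _ _ e) as [m [_ Hm]].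
now rewrite <- (Hm k (conj H1 H2)), (Hm l (conj eq_refl eq_refl)).
Qed.

Variables (Y' Y : C) (g : Y' ~> Y).

Lemma base_change_sec_eq (A : Pt Y) :
  pt_map A \o (pt_sec A \o g) = g \o idm Y'.
Proof. now rewrite comp_assoc, pt_split, comp_idl, comp_idr. Qed.

Definition base_change_ob (A : Pt Y) : Pt Y' :=
  @Build_PtOb Y' (pullback (pt_map A) g) (leg2 (pullback (pt_map A) g))
    (pb_pair (base_change_sec_eq A)) (proj2 (pb_pairE (base_change_sec_eq A))).

Lemma base_change_hom_eq (A B : Pt Y) (h : A ~> B) :
  pt_map B \o (pt_hom h \o leg1 (pullback (pt_map A) g))
  = g \o leg2 (pullback (pt_map A) g).
Proof. now rewrite comp_assoc, pt_hom_map, pullback_sq. Qed.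

Definition base_change_hom (A B : Pt Y) (h : A ~> B) :
  base_change_ob A ~> base_change_ob B.
Proof.
refine (@Build_PtHom Y' (base_change_ob A) (base_change_ob B)
          (pb_pair (base_change_hom_eq h)) (proj2 (pb_pairE (base_change_hom_eq h))) _).
destruct (pb_pairE (base_change_hom_eq h)) as [E1 E2].
destruct (pb_pairE (base_change_sec_eq A)) as [A1 A2].
destruct (pb_pairE (base_change_sec_eq B)) as [B1 B2].
apply pullback_eq; simpl.
- now rewrite comp_assoc, E1, B1, <- comp_assoc, A1, comp_assoc, pt_hom_sec.
- now rewrite comp_assoc, E2, B2, A2.
Defined.

Definition base_change : Functor (Pt Y) (Pt Y').
Proof.
refine (@Build_Functor (Pt Y) (Pt Y') base_change_ob base_change_hom _ _).
- intros A; apply PtHom_eq; simpl.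
  destruct (pb_pairE (base_change_hom_eq (idm A))) as [E1 E2].
  apply pullback_eq.
  + rewrite comp_idr; etransitivity; [exact E1 | apply comp_idl].
  + rewrite comp_idr; exact E2.
- intros A B D k h; apply PtHom_eq; simpl.
  destruct (pb_pairE (base_change_hom_eq (k \o h))) as [E1 E2].
  destruct (pb_pairE (base_change_hom_eq k)) as [K1 K2].
  destruct (pb_pairE (base_change_hom_eq h)) as [H1 H2].
  apply pullback_eq.
  + etransitivity; [exact E1 |].
    now rewrite comp_assoc, K1, <- comp_assoc, H1, comp_assoc.
  + etransitivity; [exact E2 |].
    now rewrite comp_assoc, K2, H2.
Defined.

End ChangeOfBase.
End Points.

Record protomodular (C : Category) : Prop := {
  proto_fc : finitely_complete C;
  proto_conservative : forall (Y' Y : C) (g : Y' ~> Y),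
    conservative (base_change (fc_pullbacks proto_fc) g)
}.

(** acc: algebraically cartesian closed. The unique map to a terminal object
    is [tau]; the choice of pullbacks does not affect the condition. *)
Record acc (D : Category) : Prop := {
  acc_unital : unital D;
  acc_adjoint : forall (T X : D) (tau : X ~> T), terminal T ->
    has_right_adjoint (base_change (fc_pullbacks (unital_fc acc_unital)) tau)
}.

Record facc (C : Category) : Prop := {
  facc_maltsev : maltsev C;
  facc_fibre : forall Y : C, acc (Pt Y)
}.

Record BC_facc (C : Category) : Prop := {
  BC_facc_facc : facc C;
  BC_facc_preserves : forall (Y' Y : C) (g : Y' ~> Y),
    preserves_centralizers
      (base_change (fc_pullbacks (maltsev_fc (facc_maltsev BC_facc_facc))) g)
}.

(* Main.v *)
From Corelib Require Import ssreflect ssrbool.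
From Stdlib Require Import IndefiniteDescription.
Require Import Defs.

Set Implicit Arguments.
Unset Strict Implicit.
Unset Printing Implicit Defensive.
Local Open Scope cat_scope.

(** Think of groups.  Write a map of points [v : U ~> T] over [Y] as
    [K ><| Y ~> L ><| Y], where [K] is the kernel of [U ~> Y].  The centralizer
    of [v] in [Pt Y] should be [C ><| Y], with [C] the elements of [L] that
    commute with the image of [K].  It is visible in a normalizer: embed [K] as
    the graph [x |-> (x, v x)] in the fibred product of [U] and [T] over [Y].
    The normalizer [N] of this graph consists of the pairs [(a, b)] whose two
    components induce the same conjugation on [K].  Since [K] is normal in [U],
    the map [a |-> (a, v a)] is a section [sigma] of the projection
    [pi : N ~> U], and the pairs whose first component lies in the section [Y]
    of [U] are exactly the pairs [(y, b)] where [b] acts on [K] like [y].  So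
    the centralizer [Z] is the pullback of [pi] along [pt_sec U : Y ~> U], with
    [zeta] the second projection [theta : N ~> T].

    In a protomodular category this becomes an argument with generalized
    elements.  Protomodularity says that a map of points is invertible as soon
    as it is bijective on the fibre over one map into the base
    ([iso_of_fibre_bijection]).  Applied to the relation [R] on [N] to which [K]
    is normal, it identifies [R] with the fibred product of [N] and [U] over [Y]
    ([normalizer_transport]): an element [x] of [N] can be moved inside its
    class, in exactly one way, to an element with a prescribed first component.
    Moving [z] in [Z] to first component [u] and applying [theta] is the
    cooperator of [zeta] and [v] ([centralizer_commutes]).  Conversely, if [t]
    commutes with [v] through [phi], then [(a, u) |-> (u, phi (a, u))] lifts to
    [N], because [K] sits in the product as the kernel of the first projection;
    restricting the lift along [a |-> (a, 0)] gives the factorization of [t]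
    through [zeta] ([centralizer_universal]).

    The same lift exists when the point that commutes with [v] lives over any
    [Y'] with a map [g : Y' ~> Y], because [K] is also the kernel of the pulled
    back point.  The argument is therefore carried out for data over [Y'] that
    are cartesian over [U], [T] and [Z]; [g = idm Y] gives the centralizer itself
    and the pulled back data give its stability under change of base
    ([stable_centralizers_exist]).

    It remains to turn centralizers into right adjoints.  In a unital category
    with terminal object [T], the change of base along [X ~> T] sends [B] to the
    product of [B] and [X], and a map from there to a point [E] over [X] is a
    map from [B] to the kernel of [E ~> X] that commutes with the section of
    [E].  So the right adjoint sends [E] to the intersection of this kernel with
    the centralizer of the section ([universal_arrow_of_centralizer]).  The
    fibres are unital, and the category is Mal'tsev, by the same protomodularity
    principle ([pt_injections_strongly_epic], [protomodular_maltsev]). *)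

(** Rewrites with a composite of two maps inside a longer right-nested composite. *)
Lemma precomp (C : Category) (W X Y Z : C) (g : Y ~> Z) (f : X ~> Y) (h : X ~> Z) :
  g \o f = h -> forall a : W ~> X, g \o (f \o a) = h \o a.
Proof. by move=> <- a; rewrite comp_assoc. Qed.

(** * Zero maps *)

Section Zero.
Variable C : Category.

Definition bang (T : C) (HT : terminal T) (X : C) : X ~> T :=
  proj1_sig (constructive_indefinite_description _ (HT X)).

Definition cobang (T : C) (HT : initial T) (X : C) : T ~> X :=
  proj1_sig (constructive_indefinite_description _ (HT X)).

Lemma terminal_eq (T X : C) (a b : X ~> T) : terminal T -> a = b.
Proof. by move=> /(_ X) [c [_ Hc]]; rewrite -(Hc a I) -(Hc b I). Qed.

Lemma initial_eq (T X : C) (a b : T ~> X) : initial T -> a = b.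
Proof. by move=> /(_ X) [c [_ Hc]]; rewrite -(Hc a I) -(Hc b I). Qed.

Lemma terminal_zero (T : C) : pointed C -> terminal T -> zero_object T.
Proof.
move=> [Z [Zi Zt]] HT; split=> // X.
exists (cobang Zi X \o bang Zt T); split=> // a _.
have E : bang HT Z \o bang Zt T = idm T by apply: terminal_eq.
rewrite -(comp_idr a) -E comp_assoc; congr (_ \o _).
exact: initial_eq.
Qed.

Lemma zero_map_eq (O X Y : C) (h : X ~> Y) (a : X ~> O) (b : O ~> Y) :
  zero_object O -> zero_map h -> h = b \o a.
Proof.
move=> [Oi Ot] [Z [a' [b' [[Zi Zt] ->]]]].
rewrite -(initial_eq (b \o bang Ot Z) b' Zi) -comp_assoc.
by congr (_ \o _); apply: terminal_eq.
Qed.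

Lemma zero_map_unique (X Y : C) (h k : X ~> Y) :
  zero_map h -> zero_map k -> h = k.
Proof. by move=> Hh [Z [a [b [HZ ->]]]]; apply: zero_map_eq. Qed.

Lemma zero_map_precomp (W X Y : C) (h : X ~> Y) (k : W ~> X) :
  zero_map h -> zero_map (h \o k).
Proof. by move=> [Z [a [b [HZ ->]]]]; exists Z, (a \o k), b; rewrite comp_assoc. Qed.

Lemma zero_map_through (O X Y : C) (a : X ~> O) (b : O ~> Y) :
  zero_object O -> zero_map (b \o a).
Proof. by move=> HO; exists O, a, b. Qed.

End Zero.

(** * Products, equalizers and universal arrows *)

Section Limits.
Variable C : Category.

Lemma product_of_pullback (T X Y P : C) (f : X ~> T) (g : Y ~> T)
    (p : P ~> X) (q : P ~> Y) :
  terminal T -> is_pullback f g p q -> is_product p q.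
Proof. by move=> HT [_ H] S a b; apply: H; apply: terminal_eq. Qed.

Lemma product_eq (X Y P S : C) (p : P ~> X) (q : P ~> Y) (a b : S ~> P) :
  is_product p q -> p \o a = p \o b -> q \o a = q \o b -> a = b.
Proof.
move=> H Ep Eq; have [k [_ Hk]] := H S (p \o b) (q \o b).
by rewrite -(Hk a) // -(Hk b).
Qed.

Lemma has_products (fc : finitely_complete C) (X Y : C) :
  exists (P : C) (p : P ~> X) (q : P ~> Y), is_product p q.
Proof.
case: fc => [[T HT] pb].
have [P HP] := pb X Y T (bang HT X) (bang HT Y).
by exists P, (leg1 P), (leg2 P); exact: product_of_pullback HP.
Qed.

Lemma has_equalizers (fc : finitely_complete C) (A W : C) (a b : A ~> W) :
  exists (E : C) (e : E ~> A), a \o e = b \o e /\ monic e /\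
    forall (T : C) (x : T ~> A), a \o x = b \o x -> exists y, e \o y = x.
Proof.
have [P [p [q HP]]] := has_products fc W W.
have [ab [[Ea Eb] _]] := HP _ a b.
have [d [[Dp Dq] _]] := HP _ (idm W) (idm W).
have [E [sq HE]] := fc_pullbacks fc ab d.
have pe : a \o leg1 E = leg2 E.
  by rewrite -Ea -comp_assoc sq comp_assoc Dp comp_idl.
have qe : b \o leg1 E = leg2 E.
  by rewrite -Eb -comp_assoc sq comp_assoc Dq comp_idl.
have lift T (x : T ~> A) : a \o x = b \o x -> ab \o x = d \o (a \o x).
  by move=> Ex; apply: (product_eq HP); rewrite !comp_assoc ?Ea ?Eb ?Dp ?Dq comp_idl.
exists E, (leg1 E); split; [by rewrite pe qe | split].
- move=> T x y Exy.
  have [|k [_ Hk]] := HE T (leg1 E \o y) (leg2 E \o y); first by rewrite !comp_assoc sq.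
  by rewrite -(Hk y) //; symmetry; apply: Hk; split=> //; rewrite -pe -!comp_assoc Exy.
- move=> T x Ex; have [k [[Hk _] _]] := HE T x (a \o x) (lift T x Ex).
  by exists k.
Qed.

(** Joint strong epicness, tested on the equalizer of the two maps. *)
Lemma jointly_epic (fc : finitely_complete C) (A B Z W : C) (i : A ~> Z) (j : B ~> Z)
    (a b : Z ~> W) :
  jointly_strongly_epic i j -> a \o i = b \o i -> a \o j = b \o j -> a = b.
Proof.
move=> H Ei Ej; have [E [e [He [me lift]]]] := has_equalizers fc a b.
have [i' Hi'] := lift _ i Ei; have [j' Hj'] := lift _ j Ej.
have [d Hd] := H E Z e (idm Z) i' j' me (eq_trans Hi' (eq_sym (comp_idl _)))
  (eq_trans Hj' (eq_sym (comp_idl _))).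
by rewrite -(comp_idr a) -(comp_idr b) -Hd !comp_assoc He.
Qed.

End Limits.

(** The universal arrows only merely exist, so the object and arrow parts of the
    adjoint come from choice; uniqueness of factorizations makes them functorial. *)
Lemma right_adjoint_of_universal_arrows (C D : Category) (F : Functor C D) :
  (forall Y : D, exists (G : C) (eps : F G ~> Y),
     forall (X : C) (f : F X ~> Y), exists! g : X ~> G, eps \o fmap F g = f) ->
  has_right_adjoint F.
Proof.
move=> H.
pose G Y := proj1_sig (constructive_indefinite_description _ (H Y)).
have HG Y := proj2_sig (constructive_indefinite_description _ (H Y)) : exists eps, _.
pose eps Y : F (G Y) ~> Y := proj1_sig (constructive_indefinite_description _ (HG Y)).
have Heps Y : forall X (f : F X ~> Y), exists! g, eps Y \o fmap F g = f.
  exact: (proj2_sig (constructive_indefinite_description _ (HG Y))).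
pose tr X Y (f : F X ~> Y) := proj1_sig (constructive_indefinite_description _ (Heps Y X f)).
have trE X Y (f : F X ~> Y) : eps Y \o fmap F (tr X Y f) = f.
  by case: (proj2_sig (constructive_indefinite_description _ (Heps Y X f))).
have trU X Y (f : F X ~> Y) g : eps Y \o fmap F g = f -> tr X Y f = g.
  by case: (proj2_sig (constructive_indefinite_description _ (Heps Y X f))) => _; apply.
pose Gmap X Y (h : X ~> Y) := tr _ _ (h \o eps X).
have Gid X : Gmap X X (idm X) = idm (G X).
  by apply: trU; rewrite fmap_id comp_idl comp_idr.
have Gcomp X Y Z (g : Y ~> Z) (f : X ~> Y) : Gmap _ _ (g \o f) = Gmap _ _ g \o Gmap _ _ f.
  by apply: trU; rewrite fmap_comp comp_assoc trE -!comp_assoc trE.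
pose GF := @Build_Functor D C G Gmap Gid Gcomp; exists GF.
constructor.
refine (@Build_Adjunction C D F GF tr (fun X Y g => eps Y \o fmap F g) _ _ _).
- exact: trE.
- by move=> X Y g; apply: trU.
- move=> X X' Y Y' a f b /=; apply: trU.
  by rewrite !fmap_comp !comp_assoc trE -[X in X \o _]comp_assoc trE.
Qed.

(** * Right adjoints from centralizers *)

Section Acc.
Variables (D : Category) (HD : unital D).
Let pb := fc_pullbacks (unital_fc HD).

Section Terminal.
Variables (T X : D) (tau : X ~> T) (HT : terminal T).
Let ZT : zero_object T := terminal_zero (unital_pointed HD) HT.

Lemma product_inj1_eq (B : Pt T) :
  pt_map B \o idm (pt_dom B) = tau \o (cobang (proj1 ZT) X \o bang HT (pt_dom B)).
Proof. exact: terminal_eq. Qed.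

(** The pullback of [B ~> T] along [X ~> T] is a product because [T] is terminal,
    and [T] is even a zero object.  This is the injection [(1,0)]; the section of
    the pulled back point is the injection [(0,1)]. *)
Definition product_inj1 (B : Pt T) : pt_dom B ~> pt_dom (base_change pb tau B) :=
  pb_pair pb (product_inj1_eq B).

Lemma base_change_is_product (B : Pt T) :
  is_product (leg1 (pullback pb (pt_map B) tau)) (leg2 (pullback pb (pt_map B) tau)).
Proof. exact: product_of_pullback HT (pullbackP _ _ _). Qed.

Lemma base_change_injections (B : Pt T) :
  injections (leg1 (pullback pb (pt_map B) tau)) (leg2 (pullback pb (pt_map B) tau))
    (product_inj1 B) (pt_sec (base_change pb tau B)).
Proof.
have [E1 E2] := pb_pairE pb (product_inj1_eq B).
have [F1 F2] := pb_pairE pb (base_change_sec_eq tau B).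
split; split=> //.
- by rewrite E2; apply: zero_map_through.
- by rewrite F1; apply: zero_map_through.
Qed.

Arguments base_change_is_product B : clear implicits.
Arguments base_change_injections B : clear implicits.

Lemma base_change_epic (B : Pt T) (W : D) (a b : pt_dom (base_change pb tau B) ~> W) :
  a \o product_inj1 B = b \o product_inj1 B ->
  a \o pt_sec (base_change pb tau B) = b \o pt_sec (base_change pb tau B) -> a = b.
Proof.
apply: (jointly_epic (unital_fc HD)).
exact (unital_epic HD (base_change_is_product B) (base_change_injections B)).
Qed.

(** [G] is the kernel of the composite of [zeta] with [E ~> X], and the counit is
    the cooperator of [zeta] and the section of [E], restricted to the product of
    [G] and [X].  Maps out of such products are compared on the two injections. *)
Lemma universal_arrow_of_centralizer (E : Pt X) (Z : D) (zeta : Z ~> pt_dom E) :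
  is_centralizer (pt_sec E) zeta ->
  exists (G : Pt T) (eps : base_change pb tau G ~> E),
    forall (B : Pt T) (f : base_change pb tau B ~> E),
      exists! g : B ~> G, eps \o fmap (base_change pb tau) g = f.
Proof.
case=> [[P [pz [px [i [j [phi [HP [[[pzi pxi] [pzj pxj]] [phi_i phi_j]]]]]]]]] Huniv].
pose S := pullback pb (pt_map E \o zeta) (cobang (proj1 ZT) X).
pose kap := leg1 S.
have kap0 : pt_map E \o (zeta \o kap) = cobang (proj1 ZT) X \o leg2 S.
  by rewrite comp_assoc; apply: pullback_sq.
pose G : Pt T := Build_PtOb (terminal_eq (bang HT S \o cobang (proj1 ZT) S) (idm T) HT).
have [e [[Ez Ex] _]] := HP _ (kap \o leg1 (pullback pb (pt_map G) tau))
  (leg2 (pullback pb (pt_map G) tau)).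
have [[G1 G2] [G3 G4]] := base_change_injections G.
have ei : e \o product_inj1 G = i \o kap.
  apply: (product_eq HP); rewrite !comp_assoc ?Ez ?Ex ?pzi.
    by rewrite -comp_assoc G1 comp_idl comp_idr.
  exact: zero_map_unique G2 (zero_map_precomp _ pxi).
have ej : e \o pt_sec (base_change pb tau G) = j.
  apply: (product_eq HP); rewrite !comp_assoc ?Ez ?Ex; last by rewrite G4 pxj.
  rewrite -comp_assoc (zero_map_eq tau (cobang (proj1 ZT) _) ZT G3) comp_assoc.
  exact: zero_map_unique (zero_map_through _ _ ZT) pzj.
have epsi : (phi \o e) \o product_inj1 G = zeta \o kap.
  by rewrite -comp_assoc ei comp_assoc phi_i.
have epsj : (phi \o e) \o pt_sec (base_change pb tau G) = pt_sec E.
  by rewrite -comp_assoc ej phi_j.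
have eps_map : pt_map E \o (phi \o e) = pt_map (base_change pb tau G).
  apply: base_change_epic; rewrite -comp_assoc ?epsi ?epsj; last by rewrite !pt_split.
  by rewrite kap0; apply: zero_map_unique G2; apply: zero_map_through.
pose eps := @Build_PtHom D X (base_change pb tau G) E (phi \o e) eps_map epsj.
exists G, eps => B f.
have [[B1 B2] [B3 B4]] := base_change_injections B.
have fi : commute (pt_hom f \o product_inj1 B) (pt_sec E).
  exists _, (leg1 (pullback pb (pt_map B) tau)), (leg2 (pullback pb (pt_map B) tau)).
  exists (product_inj1 B), (pt_sec (base_change pb tau B)), (pt_hom f); split; first exact: base_change_is_product.
  split; first exact: base_change_injections.
  by split=> //; exact: (pt_hom_sec f).
have [k [Hk Uk]] := Huniv _ _ fi.
have sq : (pt_map E \o zeta) \o k = cobang (proj1 ZT) X \o bang HT (pt_dom B).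
  rewrite -comp_assoc Hk comp_assoc (pt_hom_map f).
  by rewrite [LHS](zero_map_eq (bang HT _) (cobang (proj1 ZT) _) ZT B2).
have [g1 g2] := pb_pairE pb sq.
have ginj (g : B ~> G) :
  pt_hom (fmap (base_change pb tau) g) \o product_inj1 B = product_inj1 G \o pt_hom g.
  have [E1 E2] := pb_pairE pb (base_change_hom_eq pb tau g).
  apply: pullback_eq.
    apply: eq_trans (precomp E1 _) _.
    by rewrite -comp_assoc B1 comp_assoc G1 comp_idl comp_idr.
  apply: eq_trans (precomp E2 _) _; rewrite comp_assoc.
  exact: zero_map_unique B2 (zero_map_precomp _ G2).
have eps_inj (g : B ~> G) :
  pt_hom (pt_comp eps (fmap (base_change pb tau) g)) \o product_inj1 B
  = zeta \o (kap \o pt_hom g).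
  change ((phi \o e) \o pt_hom (fmap (base_change pb tau) g) \o product_inj1 B
    = zeta \o (kap \o pt_hom g)).
  rewrite -comp_assoc ginj; apply: eq_trans (precomp epsi _) _.
  by rewrite comp_assoc.
have g0 : pb_pair pb sq \o pt_sec B = pt_sec G by apply: initial_eq; case: ZT.
exists (@Build_PtHom _ T B G _ (terminal_eq _ _ HT) g0); split.
- apply: PtHom_eq; apply: base_change_epic.
    by apply: eq_trans (eps_inj _) _; rewrite /= g1.
  exact: eq_trans (pt_hom_sec _) (eq_sym (pt_hom_sec _)).
- move=> g Hg; apply: PtHom_eq; apply: pullback_eq; last by apply: terminal_eq.
  rewrite /= g1; apply: Uk.
  by apply: eq_trans (eq_sym (eps_inj g)) _; rewrite -Hg.
Qed.

End Terminal.

Lemma acc_of_centralizers :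
  (forall (U T : D) (v : U ~> T), monic v ->
     exists (Z : D) (zeta : Z ~> T), is_centralizer v zeta) -> acc D.
Proof.
move=> Hc; exists HD => T X tau HT.
apply: right_adjoint_of_universal_arrows => E.
have [|Z [zeta Hz]] := Hc _ _ (pt_sec E).
  by move=> S a b Eab; rewrite -(comp_idl a) -(comp_idl b) -(pt_split E) -!comp_assoc Eab.
exact: universal_arrow_of_centralizer Hz.
Qed.

End Acc.

(** * Limits and zero maps in a fibre *)

Section PointsBasics.
Variable C : Category.

Lemma pt_iso (Y : C) (A B : Pt Y) (h : A ~> B) : iso (pt_hom h) -> iso h.
Proof.
move=> [k [kh hk]].
have k_map : pt_map A \o k = pt_map B.
  by rewrite -(pt_hom_map h) -comp_assoc hk comp_idr.
have k_sec : k \o pt_sec B = pt_sec A.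
  by rewrite -(pt_hom_sec h) comp_assoc kh comp_idl.
by exists (Build_PtHom k_map k_sec); split; apply: PtHom_eq.
Qed.

(** The kernel pair of the underlying map carries a section, so it lives in the
    fibre, where its two projections have to agree. *)
Lemma pt_monic (pb : has_pullbacks C) (Y : C) (A B : Pt Y) (m : A ~> B) :
  monic m -> monic (pt_hom m).
Proof.
move=> Hm T a b Eab.
pose K := pullback pb (pt_hom m) (pt_hom m).
have sqK : pt_hom m \o leg1 K = pt_hom m \o leg2 K := pullback_sq pb _ _.
have [s [s1 s2]] := pullback_ex pb (eq_refl (pt_hom m \o pt_sec A)).
have Ks : (pt_map A \o leg1 K) \o s = idm Y by rewrite -comp_assoc s1 pt_split.
have K2 : pt_map A \o leg2 K = pt_map A \o leg1 K.
  by rewrite -(pt_hom_map m) -!comp_assoc sqK.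
pose KP : Pt Y := Build_PtOb Ks.
pose p1 : KP ~> A := @Build_PtHom C Y KP A (leg1 K) eq_refl s1.
pose p2 : KP ~> A := @Build_PtHom C Y KP A (leg2 K) K2 s2.
have Ep : p1 = p2 by apply: Hm; apply: PtHom_eq.
have [k [<- <-]] := pullback_ex pb Eab.
by change (pt_hom p1 \o k = pt_hom p2 \o k); rewrite Ep.
Qed.

Definition pt_zero (Y : C) : Pt Y := Build_PtOb (comp_idl (idm Y)).

Lemma pt_zero_object (Y : C) : zero_object (pt_zero Y).
Proof.
split=> A.
- exists (@Build_PtHom C Y (pt_zero Y) A (pt_sec A) (pt_split A) (comp_idr _)).
  split=> // h _; apply: PtHom_eq => /=.
  by rewrite -(pt_hom_sec h) comp_idr.
- exists (@Build_PtHom C Y A (pt_zero Y) (pt_map A) (comp_idl _) (pt_split A)).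
  split=> // h _; apply: PtHom_eq => /=.
  by rewrite -(pt_hom_map h) comp_idl.
Qed.

Lemma pt_zero_mapP (Y : C) (A B : Pt Y) (h : A ~> B) :
  zero_map h <-> pt_hom h = pt_sec B \o pt_map A.
Proof.
pose a := @Build_PtHom C Y A (pt_zero Y) (pt_map A) (comp_idl _) (pt_split A).
pose b := @Build_PtHom C Y (pt_zero Y) B (pt_sec B) (pt_split B) (comp_idr _).
split=> [Hh | E].
- by rewrite (zero_map_eq (a : A ~> pt_zero Y) b (pt_zero_object Y) Hh).
- exists (pt_zero Y), a, b; split; [exact: pt_zero_object | exact: PtHom_eq].
Qed.

Section Pullbacks.
Variables (pb : has_pullbacks C) (Y : C) (A B Z : Pt Y) (f : A ~> Z) (g : B ~> Z).
Let P := pullback pb (pt_hom f) (pt_hom g).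

Lemma pt_pullback_sec_eq : pt_hom f \o pt_sec A = pt_hom g \o pt_sec B.
Proof. by rewrite !pt_hom_sec. Qed.

Lemma pt_pullback_split :
  (pt_map A \o leg1 P) \o pb_pair pb pt_pullback_sec_eq = idm Y.
Proof.
have [E _] := pb_pairE pb pt_pullback_sec_eq.
by rewrite -comp_assoc E pt_split.
Qed.

Definition pt_pullback : Pt Y := Build_PtOb pt_pullback_split.

Definition pt_pullback1 : pt_pullback ~> A :=
  @Build_PtHom C Y pt_pullback A (leg1 P) eq_refl (proj1 (pb_pairE pb pt_pullback_sec_eq)).

Lemma pt_pullback2_map : pt_map B \o leg2 P = pt_map pt_pullback.
Proof.
rewrite /= -(pt_hom_map f) -(pt_hom_map g) -!comp_assoc.
by rewrite (pullback_sq pb (pt_hom f) (pt_hom g)).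
Qed.

Definition pt_pullback2 : pt_pullback ~> B :=
  @Build_PtHom C Y pt_pullback B (leg2 P) pt_pullback2_map
    (proj2 (pb_pairE pb pt_pullback_sec_eq)).

Lemma pt_pullbackP : is_pullback f g pt_pullback1 pt_pullback2.
Proof.
split=> [|T a b E]; first by apply: PtHom_eq; apply: pullback_sq.
have E' : pt_hom f \o pt_hom a = pt_hom g \o pt_hom b := f_equal (@pt_hom _ _ _ _) E.
have [k [k1 k2]] := pullback_ex pb E'.
have k_map : pt_map pt_pullback \o k = pt_map T.
  by rewrite /= -comp_assoc k1 pt_hom_map.
have k_sec : k \o pt_sec T = pt_sec pt_pullback.
  have [s1 s2] := pb_pairE pb pt_pullback_sec_eq.
  apply: pullback_eq; rewrite comp_assoc ?k1 ?k2 pt_hom_sec.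
    exact: eq_sym s1.
  exact: eq_sym s2.
exists (Build_PtHom k_map k_sec); split.
- by split; apply: PtHom_eq.
- move=> l [l1 l2]; apply: PtHom_eq; apply: pullback_eq.
  + by rewrite k1 -l1.
  + by rewrite k2 -l2.
Qed.

End Pullbacks.

Lemma pt_finitely_complete (pb : has_pullbacks C) (Y : C) : finitely_complete (Pt Y).
Proof.
split; first by exists (pt_zero Y); case: (pt_zero_object Y).
move=> A B Z f g.
exists (Build_Span (pt_pullback1 pb f g) (pt_pullback2 pb f g)).
exact: pt_pullbackP.
Qed.

(** Products in a fibre are only given up to isomorphism; this transfers the
    universal property of the constructed fibred product, so that they have
    generalized elements at stages that are not points. *)
Lemma pt_product_is_pullback (pb : has_pullbacks C) (Y : C) (A B P : Pt Y)
    (p : P ~> A) (q : P ~> B) :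
  is_product p q -> is_pullback (pt_map A) (pt_map B) (pt_hom p) (pt_hom q).
Proof.
move=> HP.
pose f : A ~> pt_zero Y := bang (proj2 (pt_zero_object Y)) A.
pose g : B ~> pt_zero Y := bang (proj2 (pt_zero_object Y)) B.
have Ef : pt_map A = pt_hom f by rewrite -(pt_hom_map f) comp_idl.
have Eg : pt_map B = pt_hom g by rewrite -(pt_hom_map g) comp_idl.
have HQ : is_product (pt_pullback1 pb f g) (pt_pullback2 pb f g).
  exact: product_of_pullback (proj2 (pt_zero_object Y)) (pt_pullbackP _ _ _).
have [e [[e1 e2] _]] := HP _ (pt_pullback1 pb f g) (pt_pullback2 pb f g).
have [k [[k1 k2] _]] := HQ _ p q.
have ek : e \o k = idm P.
  by apply: (product_eq HP); rewrite comp_assoc ?e1 ?e2 ?k1 ?k2 comp_idr.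
split; first by rewrite !pt_hom_map.
move=> T a b; rewrite Ef Eg => E.
have [l [l1 l2]] := pullback_ex pb E.
exists (pt_hom e \o l); split; first split.
- by rewrite comp_assoc; change (pt_hom (p \o e) \o l = a); rewrite e1.
- by rewrite comp_assoc; change (pt_hom (q \o e) \o l = b); rewrite e2.
- move=> x [x1 x2].
  have <- : pt_hom (e \o k) \o x = x by rewrite ek /= comp_idl.
  rewrite /= -comp_assoc; congr (_ \o _); apply: pullback_eq.
    rewrite l1 comp_assoc.
    by change (a = pt_hom (pt_pullback1 pb f g \o k) \o x); rewrite k1.
  rewrite l2 comp_assoc.
  by change (b = pt_hom (pt_pullback2 pb f g \o k) \o x); rewrite k2.
Qed.

End PointsBasics.

(** * Consequences of protomodularity *)

Section Protomodular.
Variables (C : Category) (Cproto : protomodular C).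
Let fc : finitely_complete C := proto_fc Cproto.
Let pb : has_pullbacks C := fc_pullbacks fc.

(** Conservativity of the change of base along [g], in terms of generalized
    elements: the hypothesis says that the pullback of [h] along [g] is bijective. *)
Lemma iso_of_fibre_bijection (Y' Y : C) (g : Y' ~> Y) (A B : Pt Y) (h : A ~> B) :
  (forall (T : C) (b : T ~> pt_dom B) (y : T ~> Y'), pt_map B \o b = g \o y ->
     exists! a, pt_hom h \o a = b) ->
  iso (pt_hom h).
Proof.
move=> H.
suff [k [kh hk]] : iso h.
  by exists (pt_hom k); split; [rewrite -[RHS]/(pt_hom (idm A)) -kh
                               | rewrite -[RHS]/(pt_hom (idm B)) -hk].
apply: (@proto_conservative C Cproto Y' Y g A B h); apply: pt_iso.
have [h1 h2] := pb_pairE pb (base_change_hom_eq pb g h).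
pose QB := pullback pb (pt_map B) g.
pose QA := pullback pb (pt_map A) g.
have [a [Ha Ua]] := H QB (leg1 QB) (leg2 QB) (pullback_sq pb _ _).
have sq : pt_map A \o a = g \o leg2 QB.
  by rewrite -(pt_hom_map h) -comp_assoc Ha; apply: pullback_sq.
have [k [k1 k2]] := pullback_ex pb sq.
exists k; split; apply: pullback_eq.
- rewrite comp_assoc k1 comp_idr.
  have sqB : pt_map B \o (pt_hom h \o leg1 QA) = g \o leg2 QA := base_change_hom_eq pb g h.
  have [c [_ Uc]] := H QA (pt_hom h \o leg1 QA) (leg2 QA) sqB.
  rewrite -(Uc (leg1 QA)) //; symmetry; apply: Uc.
  rewrite comp_assoc Ha; exact: h1.
- rewrite comp_assoc k2 comp_idr; exact: h2.
- apply: eq_trans (precomp h1 _) _.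
  by rewrite -comp_assoc k1 Ha comp_idr.
- apply: eq_trans (precomp h2 _) _.
  by rewrite k2 comp_idr.
Qed.

(** A subobject that contains the section and one fibre is everything, because it
    is itself a point over [Y].  This is the form in which protomodularity is used
    in the next lemmas. *)
Lemma section_and_fibre_cover (Y' Y : C) (g : Y' ~> Y) (B : Pt Y) (M : C)
    (m : M ~> pt_dom B) (s : Y ~> M) :
  monic m -> m \o s = pt_sec B ->
  (forall (T : C) (b : T ~> pt_dom B) (y : T ~> Y'), pt_map B \o b = g \o y ->
     exists a, m \o a = b) ->
  exists d, m \o d = idm (pt_dom B).
Proof.
move=> Hm Hs H.
have sp : (pt_map B \o m) \o s = idm Y by rewrite -comp_assoc Hs pt_split.
pose A : Pt Y := Build_PtOb sp.
pose h : A ~> B := @Build_PtHom C Y A B m eq_refl Hs.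
have [|k [_ hk]] := @iso_of_fibre_bijection _ _ g A B h; last by exists k.
move=> T b y Eb; have [a Ea] := H T b y Eb.
by exists a; split=> // a' Ea'; apply: Hm; rewrite Ea.
Qed.

(** The equalizer of [a] and [b] contains the section and the fibre. *)
Lemma section_and_fibre_epic (Y' Y : C) (g : Y' ~> Y) (B : Pt Y) (W : C)
    (a b : pt_dom B ~> W) :
  a \o pt_sec B = b \o pt_sec B ->
  (forall (T : C) (x : T ~> pt_dom B) (y : T ~> Y'), pt_map B \o x = g \o y ->
     a \o x = b \o x) ->
  a = b.
Proof.
move=> Es H.
have [E [e [He [me lift]]]] := has_equalizers fc a b.
have [s Hs] := lift _ _ Es.
have [|d Hd] := section_and_fibre_cover (g := g) me Hs.
  by move=> T x y Ex; apply: lift; apply: H Ex.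
by rewrite -(comp_idr a) -(comp_idr b) -Hd !comp_assoc He.
Qed.

(** The product, seen as a point over [A] through [p] with section [i], has as
    fibre over [pt_sec A] the image of [j].  Stated for the underlying maps, so
    that it also compares maps out of the product that are not maps of points. *)
Lemma pt_injections_strongly_epic (Y : C) (A B P : Pt Y) (p : P ~> A) (q : P ~> B)
    (i : A ~> P) (j : B ~> P) :
  is_product p q -> injections p q i j -> jointly_strongly_epic (pt_hom i) (pt_hom j).
Proof.
move=> HP [[pi qi] [pj qj]] M D m h a' b' Hm Ea Eb.
have [sqP HPb] := pt_product_is_pullback pb HP.
have {}pi : pt_hom p \o pt_hom i = idm (pt_dom A) := f_equal (@pt_hom _ _ _ _) pi.
have {}qj : pt_hom q \o pt_hom j = idm (pt_dom B) := f_equal (@pt_hom _ _ _ _) qj.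
have {}pj : pt_hom p \o pt_hom j = pt_sec A \o pt_map B := proj1 (pt_zero_mapP _) pj.
pose Q := pullback pb h m.
have sq : h \o leg1 Q = m \o leg2 Q := pullback_sq pb _ _.
have Qm : monic (leg1 Q).
  move=> T x y Exy; apply: pullback_eq => //; apply: Hm.
  by rewrite !comp_assoc -sq -!comp_assoc Exy.
pose PA : Pt (pt_dom A) := Build_PtOb pi.
have [s [s1 _]] := pullback_ex pb (eq_sym Ea).
have [|d Hd] := @section_and_fibre_cover _ _ (pt_sec A) PA _ _ _ Qm s1.
  move=> T x y /= Ex.
  have Ey : pt_map B \o (pt_hom q \o x) = y.
    by rewrite comp_assoc -sqP -comp_assoc Ex comp_assoc pt_split comp_idl.
  have Ejx : x = pt_hom j \o (pt_hom q \o x).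
    have [|k [_ Uk]] := HPb T (pt_hom p \o x) (pt_hom q \o x).
      by rewrite !comp_assoc sqP.
    rewrite -[LHS]Uk //; apply: Uk; split; last by rewrite (precomp qj) comp_idl.
    by rewrite (precomp pj) -comp_assoc Ey.
  have Ehx : h \o x = m \o (b' \o (pt_hom q \o x)).
    by rewrite [in LHS]Ejx !comp_assoc Eb.
  by have [k [k1 _]] := pullback_ex pb Ehx; exists k.
by exists (leg2 Q \o d); rewrite comp_assoc -sq -comp_assoc Hd comp_idr.
Qed.

Lemma pt_unital (Y : C) : unital (Pt Y).
Proof.
split; [by exists (pt_zero Y); apply: pt_zero_object | exact: pt_finitely_complete |].
move=> A B P p q i j HP Hij M D m h a' b' Hm Ea Eb.
have {}Hm := pt_monic pb Hm.
have [d Hd] := pt_injections_strongly_epic HP Hij Hm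
  (f_equal (@pt_hom _ _ _ _) Ea) (f_equal (@pt_hom _ _ _ _) Eb).
have d_map : pt_map M \o d = pt_map P.
  by rewrite -(pt_hom_map m) -comp_assoc Hd; exact: (pt_hom_map h).
have d_sec : d \o pt_sec P = pt_sec M.
  apply: Hm; rewrite comp_assoc Hd.
  exact: eq_trans (pt_hom_sec h) (eq_sym (pt_hom_sec m)).
by exists (@Build_PtHom C Y P M _ d_map d_sec); apply: PtHom_eq.
Qed.

Lemma related_subobject (P X R : C) (d0 d1 : R ~> X) (x y : P ~> X) :
  relation d0 d1 ->
  exists (M : C) (m : M ~> P), monic m /\ related d0 d1 (x \o m) (y \o m) /\
    forall (T : C) (p : T ~> P), related d0 d1 (x \o p) (y \o p) -> exists q, m \o q = p.
Proof.
move=> HR.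
pose Q := pullback pb x d0.
have sq : x \o leg1 Q = d0 \o leg2 Q := pullback_sq pb _ _.
have [M [e [Ee [me lift]]]] := has_equalizers fc (y \o leg1 Q) (d1 \o leg2 Q).
exists M, (leg1 Q \o e); split; [|split].
- move=> T a b; rewrite -!comp_assoc => Eab; apply: me; apply: pullback_eq => //.
  apply: HR; first by rewrite !(precomp (eq_sym sq)) -!comp_assoc Eab.
  by rewrite !comp_assoc -Ee -!comp_assoc Eab.
- by exists (leg2 Q \o e); rewrite !comp_assoc sq Ee.
- move=> T p [r [r0 r1]].
  have [k [k1 k2]] := pullback_ex pb (eq_sym r0).
  have [|q Hq] := lift T k.
    by rewrite -!comp_assoc k1 k2.
  by exists q; rewrite -comp_assoc Hq.
Qed.

Lemma related_precomp (X R S T : C) (d0 d1 : R ~> X) (x y : S ~> X) (a : T ~> S) :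
  related d0 d1 x y -> related d0 d1 (x \o a) (y \o a).
Proof. by move=> [r [<- <-]]; exists (r \o a); rewrite !comp_assoc. Qed.

(** Consider the triples [(x, y, z)] with [x R y] and [x R z] as a point over [R]
    through [(x, y)], with section [(x, y) |-> (x, y, y)].  The triples with
    [y R z] contain the section by reflexivity, and the fibre over the diagonal of
    [R], where [y = x].  So they are all triples. *)
Lemma reflexive_relation_euclidean (X R : C) (d0 d1 : R ~> X) :
  reflexive_relation d0 d1 ->
  forall (T : C) (x y z : T ~> X),
    related d0 d1 x y -> related d0 d1 x z -> related d0 d1 y z.
Proof.
move=> [HR Hrefl].
have [s0 [s00 s01]] := Hrefl X (idm X).
pose P := pullback pb d0 d0.
have sqP : d0 \o leg1 P = d0 \o leg2 P := pullback_sq pb _ _.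
have [t [t1 t2]] := pullback_ex pb (eq_refl (d0 \o idm R)).
pose B : Pt R := @Build_PtOb C R P (leg1 P) t t1.
have [M [m [Mm [Mrel Mlift]]]] := related_subobject (d1 \o leg1 P) (d1 \o leg2 P) HR.
have [s Hs] : exists s, m \o s = t.
  by apply: Mlift; rewrite -!comp_assoc t1 t2; apply: Hrefl.
have [|d Hd] := @section_and_fibre_cover _ _ s0 B _ _ _ Mm Hs.
  move=> S b u /= Eb; apply: Mlift; exists (leg2 P \o b); split; last by rewrite comp_assoc.
  by rewrite comp_assoc -sqP -!comp_assoc Eb !comp_assoc s00 s01.
move=> T x y z [r [r0 r1]] [r' [r'0 r'1]].
have [k [k1 k2]] := pullback_ex pb (eq_trans r0 (eq_sym r'0)).
have := related_precomp (d \o k) Mrel.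
by rewrite -!comp_assoc (precomp Hd) comp_idl k1 k2 r1 r'1.
Qed.

(** A reflexive Euclidean relation is an equivalence relation. *)
Lemma protomodular_maltsev : maltsev C.
Proof.
split=> // X R d0 d1 Hrefl.
have Eucl := reflexive_relation_euclidean Hrefl.
have Sym : forall (T : C) (x y : T ~> X), related d0 d1 x y -> related d0 d1 y x.
  by move=> T x y Hxy; apply: Eucl Hxy _; case: Hrefl.
split=> //; split=> // T x y z Hxy Hyz.
exact: Eucl (Sym _ _ _ Hxy) Hyz.
Qed.

End Protomodular.

(** * Kernels and normal monomorphisms *)

Section Normality.
Variable C : Category.

Lemma zero_map_exists (X Y : C) : pointed C -> exists h : X ~> Y, zero_map h.
Proof.
move=> [O HO]; exists (cobang (proj1 HO) Y \o bang (proj2 HO) X).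
exact: zero_map_through.
Qed.

Lemma zero_map_postcomp (X Y Z : C) (h : X ~> Y) (k : Y ~> Z) :
  zero_map h -> zero_map (k \o h).
Proof. by move=> [O [a [b [HO ->]]]]; exists O, a, (k \o b); rewrite comp_assoc. Qed.

(** The next three lemmas express normality to an equivalence relation by
    generalized elements: [U] is contained in a single class and is saturated. *)
Lemma normal_to_related (U X R : C) (u : U ~> X) (d0 d1 : R ~> X) (T : C) (a b : T ~> U) :
  normal_to u d0 d1 -> related d0 d1 (u \o a) (u \o b).
Proof.
move=> [_ [P [p0 [p1 [u' [HP [[[E0 E1] _] _]]]]]]].
have [k [[k0 k1] _]] := HP T a b.
by exists (u' \o k); rewrite !comp_assoc E0 E1 -!comp_assoc k0 k1.
Qed.

Lemma normal_to_saturated (U X R : C) (u : U ~> X) (d0 d1 : R ~> X) (T : C)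
    (a : T ~> U) (x : T ~> X) :
  normal_to u d0 d1 -> related d0 d1 (u \o a) x -> exists b, x = u \o b.
Proof.
move=> [_ [P [p0 [p1 [u' [_ [[[_ E1] _] [[_ Hpb] _]]]]]]]] [r [r0 <-]].
have [k [[<- _] _]] := Hpb T r a r0.
by exists (p1 \o k); rewrite !comp_assoc E1.
Qed.

Lemma normal_to_intro (fc : finitely_complete C) (U X R : C) (u : U ~> X)
    (d0 d1 : R ~> X) :
  monic u -> equivalence_relation d0 d1 ->
  (forall (T : C) (a b : T ~> U), related d0 d1 (u \o a) (u \o b)) ->
  (forall (T : C) (a : T ~> U) (x : T ~> X),
     related d0 d1 (u \o a) x -> exists b, x = u \o b) ->
  normal_to u d0 d1.
Proof.
move=> Hu [[HR _] [Hsym _]] Hrel Hsat; split=> //.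
have [P [p0 [p1 HP]]] := has_products fc U U.
have [u' [E0 E1]] := Hrel P p0 p1.
have lift T (r : T ~> R) (a b : T ~> U) : d0 \o r = u \o a -> d1 \o r = u \o b ->
    exists l, u' \o l = r /\ p0 \o l = a /\ p1 \o l = b.
  move=> r0 r1; have [l [[l0 l1] _]] := HP T a b; exists l; split=> //.
  by apply: HR; rewrite comp_assoc ?E0 ?E1 -comp_assoc ?l0 ?l1.
have p0u' T (l l' : T ~> P) : u' \o l = u' \o l' -> l = l'.
  move=> E; apply: (product_eq HP); apply: Hu; rewrite !comp_assoc.
    by rewrite -E0 -!comp_assoc E.
  by rewrite -E1 -!comp_assoc E.
exists P, p0, p1, u'; split=> //; split; [|split].
- split=> // T r a b r0 r1; have [l [l0 l1]] := lift T r a b r0 r1.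
  by exists l; split=> // l' [l'0 _]; apply: p0u'; rewrite l0.
- split=> // T r a r0.
  have [|b r1] := Hsat T a (d1 \o r); first by exists r.
  have [l [l0 [l1 _]]] := lift T r a b r0 r1.
  by exists l; split=> // l' [l'0 _]; apply: p0u'; rewrite l0.
- split=> // T r b r1.
  have [|a r0] := Hsat T b (d0 \o r); first by apply: Hsym; exists r.
  have [l [l0 [_ l1]]] := lift T r a b r0 r1.
  by exists l; split=> // l' [l'0 _]; apply: p0u'; rewrite l0.
Qed.

Section KernelPair.
Variables (pb : has_pullbacks C) (X B : C) (q : X ~> B).
Let R := pullback pb q q.

Lemma kernel_pair_related (T : C) (x y : T ~> X) :
  related (leg1 R) (leg2 R) x y <-> q \o x = q \o y.
Proof.
split=> [[r [<- <-]] | E]; last by have [r Hr] := pullback_ex pb E; exists r.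
by rewrite !comp_assoc (pullback_sq pb q q).
Qed.

Lemma kernel_pair_equivalence : equivalence_relation (leg1 R) (leg2 R).
Proof.
split; first split.
- by move=> T r r'; apply: pullback_eq.
- by move=> T x; apply/kernel_pair_related.
- split=> [T x y | T x y z]; rewrite !kernel_pair_related; first by move=> ->.
  by move=> -> ->.
Qed.

End KernelPair.

(** Phrased with zero maps, which needs no choice of a zero object. *)
Definition is_kernel (K X B : C) (k : K ~> X) (q : X ~> B) : Prop :=
  [/\ monic k, zero_map (q \o k) &
      forall (T : C) (x : T ~> X), zero_map (q \o x) -> exists b, x = k \o b].

Lemma kernels_exist (Cpointed : pointed C) (pb : has_pullbacks C) (X B : C) (q : X ~> B) :
  exists (K : C) (k : K ~> X), is_kernel k q.
Proof.
case: Cpointed => O HO.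
pose K := pullback pb q (cobang (proj1 HO) B).
have sq : q \o leg1 K = cobang (proj1 HO) B \o leg2 K := pullback_sq pb _ _.
exists K, (leg1 K); split.
- move=> T a b E; apply: pullback_eq => //.
  exact: terminal_eq (proj2 HO).
- by rewrite sq; apply: zero_map_through.
- move=> T x Hx.
  have [b [b1 _]] := pullback_ex pb (zero_map_eq (bang (proj2 HO) T) (cobang (proj1 HO) B) HO Hx).
  by exists b.
Qed.

Lemma kernel_normal_to_kernel_pair (fc : finitely_complete C) (K X B : C)
    (k : K ~> X) (q : X ~> B) :
  is_kernel k q ->
  normal_to k (leg1 (pullback (fc_pullbacks fc) q q)) (leg2 (pullback (fc_pullbacks fc) q q)).
Proof.
move=> [Hk k0 lift]; apply: normal_to_intro => //; first exact: kernel_pair_equivalence.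
- move=> T a b; apply/kernel_pair_related; rewrite !comp_assoc.
  exact: zero_map_unique (zero_map_precomp _ k0) (zero_map_precomp _ k0).
- move=> T a x /kernel_pair_related E; apply: lift.
  by rewrite -E comp_assoc; apply: zero_map_precomp.
Qed.

End Normality.

Section PointedProtomodular.
Variables (C : Category) (Cpointed : pointed C) (Cproto : protomodular C).
Let fc : finitely_complete C := proto_fc Cproto.
Let pb : has_pullbacks C := fc_pullbacks fc.

(** The fibre over [0 ~> Y] is the kernel. *)
Lemma section_and_kernel_epic (Y : C) (B : Pt Y) (W : C) (a b : pt_dom B ~> W) :
  a \o pt_sec B = b \o pt_sec B ->
  (forall (T : C) (x : T ~> pt_dom B), zero_map (pt_map B \o x) -> a \o x = b \o x) ->
  a = b.
Proof.
case: Cpointed => O HO Es H.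
apply: (section_and_fibre_epic Cproto (g := cobang (proj1 HO) Y) Es) => T x y E.
by apply: H; rewrite E; apply: zero_map_through.
Qed.

Lemma iso_of_kernel_bijection (Y : C) (A B : Pt Y) (h : A ~> B) :
  (forall (T : C) (b : T ~> pt_dom B), zero_map (pt_map B \o b) ->
     exists! a, pt_hom h \o a = b) ->
  iso (pt_hom h).
Proof.
case: Cpointed => O HO H.
apply: (iso_of_fibre_bijection Cproto (g := cobang (proj1 HO) Y)) => T b y E.
by apply: H; rewrite E; apply: zero_map_through.
Qed.

(** * The normalizer of the graph of a map on a kernel *)

(** [N] is a normalizer of the graph [x |-> (k x, v (k x))] of [v] on the kernel [K],
    inside the fibred product of [U] and [T]; [pi] and [theta] are its two
    components.  The universal property is restricted to the case that is needed,
    where [K] is normal to the kernel pair of a map [q] as a kernel of [q].  There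
    a map of relations is a map that sends elements identified by [q] to related
    elements, and both existence and uniqueness of lifts become statements about
    generalized elements. *)
Record graph_normalizer (Y : C) (U T : Pt Y) (v : U ~> T) (K : C) (k : K ~> pt_dom U)
    (N R : C) (n : K ~> N) (d0 d1 : R ~> N)
    (pi : N ~> pt_dom U) (theta : N ~> pt_dom T) : Prop := {
  gn_equivalence : equivalence_relation d0 d1;
  gn_normal : normal_to n d0 d1;
  gn_map : pt_map U \o pi = pt_map T \o theta;
  gn_pi : pi \o n = k;
  gn_lift : forall (Q B : C) (q : Q ~> B) (u : K ~> Q) (a : Q ~> pt_dom U) (b : Q ~> pt_dom T),
    is_kernel u q -> pt_map U \o a = pt_map T \o b ->
    a \o u = k -> b \o u = pt_hom v \o k ->
    exists h : Q ~> N, [/\ pi \o h = a, theta \o h = b, h \o u = n &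
      forall (S : C) (x y : S ~> Q), q \o x = q \o y -> related d0 d1 (h \o x) (h \o y)];
  gn_unique : forall (Q B : C) (q : Q ~> B) (u : K ~> Q) (h h' : Q ~> N),
    is_kernel u q -> pi \o h = pi \o h' -> theta \o h = theta \o h' ->
    h \o u = n -> h' \o u = n ->
    (forall (S : C) (x y : S ~> Q), q \o x = q \o y -> related d0 d1 (h \o x) (h \o y)) ->
    (forall (S : C) (x y : S ~> Q), q \o x = q \o y -> related d0 d1 (h' \o x) (h' \o y)) ->
    h = h'
}.

(** The graph of [v] on [K] is monic because [k] is, so it has a normalizer. *)
Lemma graph_normalizer_exists (Cnorm : has_normalizers C) (Y : C) (U T : Pt Y) (v : U ~> T)
    (K : C) (k : K ~> pt_dom U) :
  is_kernel k (pt_map U) ->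
  exists (N R : C) (n : K ~> N) (d0 d1 : R ~> N) (pi : N ~> pt_dom U) (theta : N ~> pt_dom T),
    graph_normalizer v k n d0 d1 pi theta.
Proof.
move=> [Hk _ _].
pose P := pullback pb (pt_map U) (pt_map T).
have sqk : pt_map U \o k = pt_map T \o (pt_hom v \o k) by rewrite comp_assoc pt_hom_map.
have [khat [khat1 khat2]] := pullback_ex pb sqk.
have [|N [R [n [d0 [d1 [w [Heq [Hn [En Huniv]]]]]]]]] := Cnorm _ _ khat.
  by move=> S a b E; apply: Hk; rewrite -khat1 -!comp_assoc E.
exists N, R, n, d0, d1, (leg1 P \o w), (leg2 P \o w); split=> //.
- by rewrite !comp_assoc (pullback_sq pb (pt_map U) (pt_map T)).
- by rewrite -comp_assoc -En.
- move=> Q B q u a b Hu Eab au bu.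
  have [ab [ab1 ab2]] := pullback_ex pb Eab.
  have E : khat = ab \o u.
    by apply: pullback_eq; rewrite comp_assoc ?ab1 ?ab2 ?khat1 ?khat2.
  have [h [[wh [hu [r [r0 r1]]]] _]] := Huniv _ _ _ _ _ _
    (kernel_pair_equivalence pb q) (kernel_normal_to_kernel_pair fc Hu) E.
  exists h; split=> //; try by rewrite -comp_assoc wh.
  move=> S x y /(kernel_pair_related pb) [l [<- <-]].
  by exists (r \o l); rewrite !comp_assoc r0 r1.
- move=> Q B q u h h' Hu Epi Etheta hu h'u Hrel Hrel'.
  have Ew : w \o h = w \o h' by apply: pullback_eq; rewrite !comp_assoc.
  have E : khat = (w \o h) \o u by rewrite -comp_assoc hu.
  have [g [_ Ug]] := Huniv _ _ _ _ _ _
    (kernel_pair_equivalence pb q) (kernel_normal_to_kernel_pair fc Hu) E.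
  have sq := pullback_sq pb q q.
  transitivity g; [symmetry|]; apply: Ug; split=> //; split=> //.
  + exact: Hrel.
  + exact: Hrel'.
Qed.

Record cartesian_over (Y' Y : C) (g : Y' ~> Y) (A' : Pt Y') (A : Pt Y)
    (c : pt_dom A' ~> pt_dom A) : Prop := {
  cartesian_pullback : is_pullback (pt_map A) g c (pt_map A');
  cartesian_sec : c \o pt_sec A' = pt_sec A \o g
}.

Lemma is_pullback_eq (X1 X2 X3 Q S : C) (f : X1 ~> X3) (g : X2 ~> X3) (p : Q ~> X1)
    (q : Q ~> X2) (a b : S ~> Q) :
  is_pullback f g p q -> p \o a = p \o b -> q \o a = q \o b -> a = b.
Proof.
move=> [sq H] Ep Eq.
have [|l [_ Ul]] := H S (p \o b) (q \o b); first by rewrite !comp_assoc sq.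
by rewrite -(Ul a) // (Ul b).
Qed.

Lemma cartesian_eq (Y' Y : C) (g : Y' ~> Y) (A' : Pt Y') (A : Pt Y)
    (c : pt_dom A' ~> pt_dom A) (S : C) (a b : S ~> pt_dom A') :
  cartesian_over g c -> c \o a = c \o b -> pt_map A' \o a = pt_map A' \o b -> a = b.
Proof. by move=> [Hc _]; apply: is_pullback_eq Hc. Qed.

Section Construction.
Variables (Y : C) (U T : Pt Y) (v : U ~> T) (K : C) (k : K ~> pt_dom U).
Hypothesis k_kernel : is_kernel k (pt_map U).
Variables (N R : C) (n : K ~> N) (d0 d1 : R ~> N).
Variables (pi : N ~> pt_dom U) (theta : N ~> pt_dom T).
Hypothesis HN : graph_normalizer v k n d0 d1 pi theta.

Lemma normalizer_rel_refl (S : C) (x : S ~> N) : related d0 d1 x x.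
Proof. by case: (gn_equivalence HN) => [[_ H] _]. Qed.

Lemma normalizer_rel_sym (S : C) (x y : S ~> N) : related d0 d1 x y -> related d0 d1 y x.
Proof. by case: (gn_equivalence HN) => [_ [H _]]; apply: H. Qed.

Lemma normalizer_rel_trans (S : C) (x y z : S ~> N) :
  related d0 d1 x y -> related d0 d1 y z -> related d0 d1 x z.
Proof. by case: (gn_equivalence HN) => [_ [_ H]]; apply: H. Qed.

(** [K] is normal in [U], being a kernel, so [a |-> (a, v a)] lifts to [N]. *)
Lemma normalizer_section : exists sigma : pt_dom U ~> N,
  [/\ pi \o sigma = idm _, theta \o sigma = pt_hom v, sigma \o k = n &
    forall (S : C) (x y : S ~> pt_dom U), pt_map U \o x = pt_map U \o y ->
      related d0 d1 (sigma \o x) (sigma \o y)].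
Proof.
apply: (gn_lift HN k_kernel) => //; last exact: comp_idl.
by rewrite comp_idr pt_hom_map.
Qed.

(** Related elements lie over the same element of [Y].  Since [N] embeds in [R] as
    the diagonal, it suffices to look at the kernel of [d0], and an element related
    to zero comes from [K] by normality. *)
Lemma related_map (S : C) (x y : S ~> N) :
  related d0 d1 x y -> (pt_map U \o pi) \o x = (pt_map U \o pi) \o y.
Proof.
suff E : (pt_map U \o pi) \o d0 = (pt_map U \o pi) \o d1.
  by move=> [r [<- <-]]; rewrite (comp_assoc _ d0) (comp_assoc _ d1) E.
have [s0 [s00 s01]] := normalizer_rel_refl (idm N).
pose B : Pt N := Build_PtOb s00.
apply: (@section_and_kernel_epic _ B).
  by rewrite /= -!comp_assoc s00 s01.
move=> S' r /= Hr.
have [z Hz] := zero_map_exists S' K Cpointed.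
have Ez : n \o z = d0 \o r by apply: zero_map_unique (zero_map_postcomp _ Hz) Hr.
have [|c Hc] := normal_to_saturated (a := z) (x := d1 \o r) (gn_normal HN).
  by exists r; rewrite Ez.
case: k_kernel => _ k0 _.
rewrite -!comp_assoc Hc (precomp (gn_pi HN)); apply: zero_map_unique.
  by do 2!apply: zero_map_postcomp.
by rewrite comp_assoc; apply: zero_map_precomp.
Qed.

(** The map [R ~> N x_Y U] with components [d0] and [pi \o d1] is a map of points
    over [N], and both kernels are [K]: this is normality of [n] on the left and
    the definition of [K] on the right.  Hence it is invertible. *)
Lemma normalizer_transport (S : C) (z : S ~> N) (u : S ~> pt_dom U) :
  pt_map U \o u = pt_map U \o (pi \o z) ->
  exists! m : S ~> N, related d0 d1 z m /\ pi \o m = u.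
Proof.
have [[HR _] _] := (gn_equivalence HN).
have [s0 [s00 s01]] := normalizer_rel_refl (idm N).
pose Q := pullback pb (pt_map U \o pi) (pt_map U).
have sqR : (pt_map U \o pi) \o d0 = pt_map U \o (pi \o d1).
  by rewrite comp_assoc; apply: related_map; exists (idm R); rewrite !comp_idr.
have [h [h1 h2]] := pullback_ex pb sqR.
have [s [s1 s2]] := pullback_ex pb (comp_idr (pt_map U \o pi)).
pose A : Pt N := Build_PtOb s00.
pose B : Pt N := @Build_PtOb C N Q (leg1 Q) s s1.
have hs : h \o s0 = s.
  apply: pullback_eq; first by rewrite comp_assoc h1 s00 s1.
  by rewrite comp_assoc h2 s2 -comp_assoc s01 comp_idr.
have [|g [gh hg]] := @iso_of_kernel_bijection N A B (@Build_PtHom C N A B h h1 hs).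
  move=> S' b /= Hb.
  case: k_kernel => km k0 lift.
  have [|c Hc] := lift _ (leg2 Q \o b).
    rewrite comp_assoc -(pullback_sq pb (pt_map U \o pi) (pt_map U)) -!comp_assoc.
    by do 2!apply: zero_map_postcomp.
  have [o Ho] := zero_map_exists S' K Cpointed.
  have Eo : n \o o = leg1 Q \o b by apply: zero_map_unique Hb; apply: zero_map_postcomp.
  have [r [r0 r1]] := normal_to_related o c (gn_normal HN).
  exists r; split.
    apply: pullback_eq; first by rewrite comp_assoc h1 r0.
    by rewrite comp_assoc h2 -comp_assoc r1 comp_assoc (gn_pi HN) Hc.
  move=> r' Er'.
  have r'0 : d0 \o r' = n \o o by rewrite -h1 -comp_assoc Er' Eo.
  have [|c' Hc'] := normal_to_saturated (a := o) (x := d1 \o r') (gn_normal HN).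
    by exists r'.
  apply: HR; rewrite ?r0 ?r'0 // r1 Hc'; congr (_ \o _); apply: km.
  by rewrite -Hc -Er' comp_assoc h2 -comp_assoc Hc' comp_assoc (gn_pi HN).
rewrite /= in gh hg.
rewrite (comp_assoc (pt_map U)) => E.
have [b [b1 b2]] := pullback_ex pb (eq_sym E).
have gb : h \o (g \o b) = b by rewrite comp_assoc hg comp_idl.
exists (d1 \o (g \o b)); split.
  split; last by rewrite comp_assoc -h2 -comp_assoc gb.
  by exists (g \o b); rewrite -{1}h1 -comp_assoc gb.
move=> m [[r [r0 r1]] Hm].
suff -> : g \o b = r by [].
rewrite -[RHS]comp_idl -gh -comp_assoc; congr (_ \o _).
apply: pullback_eq; first by rewrite b1 comp_assoc h1.
by rewrite b2 comp_assoc h2 -comp_assoc r1.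
Qed.

(** * The centralizer *)

Section Centralizer.
Variables (sigma : pt_dom U ~> N) (Z : Pt Y) (z : pt_dom Z ~> N) (zeta : Z ~> T).
Hypotheses (pi_sigma : pi \o sigma = idm _) (theta_sigma : theta \o sigma = pt_hom v)
  (sigma_k : sigma \o k = n).
Hypothesis sigma_rel : forall (S : C) (x y : S ~> pt_dom U),
  pt_map U \o x = pt_map U \o y -> related d0 d1 (sigma \o x) (sigma \o y).
Hypotheses (Z_pullback : is_pullback pi (pt_sec U) z (pt_map Z))
  (z_sec : z \o pt_sec Z = sigma \o pt_sec U) (zetaE : pt_hom zeta = theta \o z).

(** Everything below is over a base [Y'] with a map to [Y], for points that are
    cartesian over [U], [T] and [Z]. *)
Section BaseChange.
Variables (Y' : C) (g : Y' ~> Y) (U' T' Z' : Pt Y') (v' : U' ~> T') (zeta' : Z' ~> T').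
Variables (cU : pt_dom U' ~> pt_dom U) (cT : pt_dom T' ~> pt_dom T)
  (cZ : pt_dom Z' ~> pt_dom Z).
Hypotheses (HU : cartesian_over g cU) (HT : cartesian_over g cT)
  (HZ : cartesian_over g cZ).
Hypotheses (Ev : cT \o pt_hom v' = pt_hom v \o cU)
  (Ezeta : cT \o pt_hom zeta' = pt_hom zeta \o cZ).

(** The kernel of a point does not change when the point is pulled back. *)
Lemma base_change_kernel : exists k' : K ~> pt_dom U', cU \o k' = k /\ is_kernel k' (pt_map U').
Proof.
case: k_kernel => km k0 klift.
have [o Ho] := zero_map_exists K Y' Cpointed.
have E : pt_map U \o k = g \o o.
  exact: zero_map_unique k0 (zero_map_postcomp _ Ho).
have [k' [[k'1 k'2] _]] := proj2 (cartesian_pullback HU) _ _ _ E.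
exists k'; split=> //; split.
- by move=> S a b Eab; apply: km; rewrite -k'1 -!comp_assoc Eab.
- by rewrite k'2.
- move=> S x Hx.
  have [|b Hb] := klift _ (cU \o x).
    by rewrite (precomp (proj1 (cartesian_pullback HU))) -comp_assoc; apply: zero_map_postcomp.
  exists b; apply: (cartesian_eq HU); first by rewrite comp_assoc k'1.
  by rewrite comp_assoc k'2; apply: zero_map_unique Hx (zero_map_precomp _ Ho).
Qed.

Section Product.
Variables (A Q : Pt Y') (p : Q ~> A) (q : Q ~> U') (i : A ~> Q) (j : U' ~> Q).
Hypotheses (HQ : is_product p q) (Hij : injections p q i j).

Lemma pi_over_section (kap : A ~> Z') :
  pi \o (z \o (cZ \o pt_hom kap)) = pt_sec U \o (g \o pt_map A).
Proof.
rewrite (precomp (proj1 Z_pullback)) -comp_assoc.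
by rewrite (precomp (proj1 (cartesian_pullback HZ))) -comp_assoc pt_hom_map.
Qed.

Lemma injections_elements :
  [/\ pt_hom p \o pt_hom i = idm _, pt_hom q \o pt_hom i = pt_sec U' \o pt_map A,
      pt_hom p \o pt_hom j = pt_sec A \o pt_map U' & pt_hom q \o pt_hom j = idm _].
Proof.
case: Hij => [[pi' /pt_zero_mapP qi] [/pt_zero_mapP pj qj]]; split=> //.
- exact: (f_equal (@pt_hom _ _ _ _) pi').
- exact: (f_equal (@pt_hom _ _ _ _) qj).
Qed.

Lemma product_kernel (k' : K ~> pt_dom U') :
  is_kernel k' (pt_map U') -> is_kernel (pt_hom j \o k') (pt_hom p).
Proof.
move=> [km k0 klift]; have [_ _ pj qj] := injections_elements.
have [_ Qpb] := pt_product_is_pullback pb HQ.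
split.
- move=> S a b; rewrite -!comp_assoc => E; apply: km.
  by rewrite -(comp_idl (k' \o a)) -(comp_idl (k' \o b)) -qj -!comp_assoc E.
- by rewrite (precomp pj) -comp_assoc; apply: zero_map_postcomp.
- move=> S x Hx.
  have [|b Hb] := klift _ (pt_hom q \o x).
    by rewrite comp_assoc pt_hom_map -(pt_hom_map p) -comp_assoc; apply: zero_map_postcomp.
  exists b.
  have [|l [_ Ul]] := Qpb _ (pt_hom p \o x) (pt_hom q \o x).
    by rewrite !comp_assoc !pt_hom_map.
  rewrite -[LHS]Ul //; apply: Ul; split.
    apply: zero_map_unique Hx; rewrite -!comp_assoc (precomp pj) -comp_assoc.
    by apply: zero_map_postcomp; rewrite comp_assoc; apply: zero_map_precomp.
  by rewrite -!comp_assoc (precomp qj) comp_idl Hb.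
Qed.

(** An element [(a, u)] of the product gives the element of [N] determined by
    [kap a], which is moved in its class until its first component is the image
    of [u].  On the two injections the result is known already, by uniqueness. *)
Lemma transport_along_product (kap : A ~> Z') :
  exists h : pt_dom Q ~> N,
    [/\ related d0 d1 (z \o (cZ \o pt_hom kap) \o pt_hom p) h, pi \o h = cU \o pt_hom q,
        h \o pt_hom i = z \o (cZ \o pt_hom kap) & h \o pt_hom j = sigma \o cU].
Proof.
have [pi' qi pj qj] := injections_elements.
have [sqU _] := cartesian_pullback HU.
have [h [[Hh Eh] _]] : exists! h, related d0 d1 (z \o (cZ \o pt_hom kap) \o pt_hom p) h /\
    pi \o h = cU \o pt_hom q.
  apply: normalizer_transport.
  rewrite (precomp sqU) -comp_assoc pt_hom_map (comp_assoc pi) pi_over_section.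
  by rewrite -!comp_assoc pt_hom_map (precomp (pt_split U)) comp_idl.
have uniq S (x m m' : S ~> N) : related d0 d1 x m -> related d0 d1 x m' ->
    pi \o m = pi \o m' -> m = m'.
  move=> Hm Hm' E.
  have [|l [_ Ul]] := normalizer_transport (z := x) (u := pi \o m).
    by rewrite !comp_assoc; apply: related_map; apply: normalizer_rel_sym.
  by rewrite -(Ul m) // (Ul m').
have Hhi := related_precomp (pt_hom i) Hh.
have Hhj := related_precomp (pt_hom j) Hh.
exists h; split=> //.
- apply: uniq Hhi _ _; first by rewrite -comp_assoc pi' comp_idr; apply: normalizer_rel_refl.
  rewrite comp_assoc Eh -comp_assoc qi pi_over_section.
  by rewrite comp_assoc (cartesian_sec HU) -comp_assoc.
- apply: uniq Hhj _ _; last first.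
    by rewrite comp_assoc Eh -comp_assoc qj comp_idr comp_assoc pi_sigma comp_idl.
  rewrite -!comp_assoc pj (precomp (pt_hom_sec kap)) (precomp (cartesian_sec HZ)).
  rewrite -!comp_assoc (precomp z_sec) -comp_assoc; apply: sigma_rel.
  by rewrite (precomp (pt_split U)) comp_idl sqU.
Qed.

End Product.

(** The cooperator is [theta] applied to the transport of [z] to first component
    [u]; it lands in [T'] because [T'] is cartesian over [T]. *)
Lemma centralizer_commutes : commute zeta' v'.
Proof.
have [Q [p [q HQ]]] := has_products (pt_finitely_complete pb Y') Z' U'.
have [o1 Ho1] := zero_map_exists Z' U' (unital_pointed (pt_unital Cproto Y')).
have [o2 Ho2] := zero_map_exists U' Z' (unital_pointed (pt_unital Cproto Y')).
have [i [[pi' qi] _]] := HQ _ (idm Z') o1.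
have [j [[pj qj] _]] := HQ _ o2 (idm U').
have Hij : injections p q i j by split; split=> //; rewrite ?qi ?pj.
have [h [_ Eh hi hj]] := transport_along_product Hij (idm Z').
have [pi'' qi' pj' qj'] := injections_elements Hij.
have sq : pt_map T \o (theta \o h) = g \o pt_map Q.
  rewrite comp_assoc -(gn_map HN) -comp_assoc Eh.
  by rewrite (precomp (proj1 (cartesian_pullback HU))) -comp_assoc pt_hom_map.
have [phi [[phi1 phi2] _]] := proj2 (cartesian_pullback HT) _ _ _ sq.
have phi_i : phi \o pt_hom i = pt_hom zeta'.
  apply: (cartesian_eq HT).
    by rewrite comp_assoc phi1 -comp_assoc hi Ezeta zetaE /= comp_idr comp_assoc.
  by rewrite comp_assoc phi2 !pt_hom_map.
have phi_j : phi \o pt_hom j = pt_hom v'.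
  apply: (cartesian_eq HT).
    by rewrite comp_assoc phi1 -comp_assoc hj Ev comp_assoc theta_sigma.
  by rewrite comp_assoc phi2 !pt_hom_map.
have phi_sec : phi \o pt_sec Q = pt_sec T'.
  by rewrite -(pt_hom_sec i) comp_assoc phi_i pt_hom_sec.
exists Q, p, q, i, j, (@Build_PtHom C Y' Q T' phi phi2 phi_sec).
by split=> //; split=> //; split; apply: PtHom_eq.
Qed.

(** [Q] is the product of [A] and [U'], and [h] lifts [(a, u) |-> (u, phi (a, u))]
    to the normalizer.  Along [j] it must be [sigma \o cU], hence its restriction
    along [i] respects the sections; along [i] it has its first component in the
    section of [U], hence factors through [Z].  For uniqueness, another
    factorization [kap'] gives by transport a second lift of the same map, and
    lifts to the normalizer are unique. *)
Lemma centralizer_universal (A : Pt Y') (t : A ~> T') :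
  commute t v' -> exists! kap : A ~> Z', zeta' \o kap = t.
Proof.
case=> [Q [p [q [i [j [phi [HQ [Hij [phi_i phi_j]]]]]]]]].
have {}phi_i : pt_hom phi \o pt_hom i = pt_hom t := f_equal (@pt_hom _ _ _ _) phi_i.
have {}phi_j : pt_hom phi \o pt_hom j = pt_hom v' := f_equal (@pt_hom _ _ _ _) phi_j.
have [pi' qi pj qj] := injections_elements Hij.
have [k' [Ek' Hk']] := base_change_kernel.
have Hker := product_kernel HQ Hij Hk'.
have [sqU _] := cartesian_pullback HU.
have [sqT _] := cartesian_pullback HT.
have [h [pih thetah hk hrel]] : exists h : pt_dom Q ~> N,
    [/\ pi \o h = cU \o pt_hom q, theta \o h = cT \o pt_hom phi, h \o (pt_hom j \o k') = n &
      forall (S : C) (x y : S ~> pt_dom Q), pt_hom p \o x = pt_hom p \o y ->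
        related d0 d1 (h \o x) (h \o y)].
{ apply: (gn_lift HN Hker).
  + by rewrite (precomp sqU) (precomp sqT) -!comp_assoc !pt_hom_map.
  + by rewrite -comp_assoc (precomp qj) comp_idl.
  + by rewrite -comp_assoc (precomp phi_j) comp_assoc Ev -comp_assoc Ek'. }
have hj : h \o pt_hom j = sigma \o cU.
{ apply: (gn_unique HN Hk').
  + by rewrite comp_assoc pih -comp_assoc qj comp_idr comp_assoc pi_sigma comp_idl.
  + by rewrite comp_assoc thetah -comp_assoc phi_j comp_assoc theta_sigma.
  + by rewrite -comp_assoc.
  + by rewrite -comp_assoc Ek'.
  + move=> S x y E; rewrite -!comp_assoc; apply: hrel.
    by rewrite !(precomp pj) -!comp_assoc E.
  + move=> S x y E; rewrite -!comp_assoc; apply: sigma_rel.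
    by rewrite !(precomp sqU) -!comp_assoc E. }
have pihi : pi \o (h \o pt_hom i) = pt_sec U \o (g \o pt_map A).
  by rewrite comp_assoc pih -comp_assoc qi comp_assoc (cartesian_sec HU) -comp_assoc.
have [x [[x1 x2] _]] := proj2 Z_pullback _ _ _ pihi.
have [kap [[kap1 kap2] _]] := proj2 (cartesian_pullback HZ) _ _ _ x2.
have kap_sec : kap \o pt_sec A = pt_sec Z'.
  apply: (cartesian_eq HZ); last by rewrite comp_assoc kap2 !pt_split.
  rewrite comp_assoc kap1 (cartesian_sec HZ).
  apply: (is_pullback_eq Z_pullback); rewrite !comp_assoc.
    rewrite x1 z_sec -comp_assoc pt_hom_sec -(pt_hom_sec j) comp_assoc hj.
    by rewrite -!comp_assoc (cartesian_sec HU).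
  by rewrite x2 pt_split comp_idl -comp_assoc pt_split comp_idr.
exists (@Build_PtHom C Y' A Z' kap kap2 kap_sec); split.
  apply: PtHom_eq; apply: (cartesian_eq HT) => /=; last by rewrite comp_assoc !pt_hom_map.
  rewrite comp_assoc Ezeta zetaE -!comp_assoc kap1 x1 comp_assoc thetah.
  by rewrite -comp_assoc phi_i.
move=> kap' Ekap'; apply: PtHom_eq => /=.
suff E : h \o pt_hom i = z \o (cZ \o pt_hom kap').
  apply: (cartesian_eq HZ); last by rewrite kap2 pt_hom_map.
  rewrite kap1.
  apply: (is_pullback_eq Z_pullback); first by rewrite x1.
  rewrite x2 comp_assoc (proj1 (cartesian_pullback HZ)).
  by rewrite -comp_assoc pt_hom_map.
(* both lifts have components [cU \o q] and [cT \o phi]: the second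
   component of [h'] is compared on the two injections of the product *)
have [h' [h'rel pih' h'i h'j]] := transport_along_product Hij kap'.
suff -> : h = h' by [].
apply: (gn_unique HN Hker) => //; first by rewrite pih.
- apply: (jointly_epic fc (pt_injections_strongly_epic Cproto HQ Hij)).
    rewrite -!comp_assoc h'i comp_assoc thetah -comp_assoc phi_i -Ekap'.
    by rewrite /= comp_assoc Ezeta zetaE -!comp_assoc.
  by rewrite -!comp_assoc hj h'j.
- by rewrite comp_assoc h'j -comp_assoc Ek'.
- move=> S a b E.
  apply: normalizer_rel_trans (normalizer_rel_sym (related_precomp a h'rel)) _.
  by rewrite -comp_assoc E comp_assoc; apply: related_precomp.
Qed.

End BaseChange.
End Centralizer.
End Construction.
End PointedProtomodular.

(** * Stability of centralizers *)

Lemma is_centralizer_iso (D : Category) (U T Z Z' : D) (v : U ~> T) (zeta : Z ~> T)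
    (zeta' : Z' ~> T) (a : Z ~> Z') (b : Z' ~> Z) :
  a \o b = idm Z' -> b \o a = idm Z -> zeta' \o a = zeta ->
  is_centralizer v zeta -> is_centralizer v zeta'.
Proof.
move=> ab ba Ea [[P [p [q [i [j [phi [HP [[[pi qi] [pj qj]] [phi_i phi_j]]]]]]]]] Huniv].
have Eb : zeta \o b = zeta' by rewrite -Ea -comp_assoc ab comp_idr.
split.
- exists P, (a \o p), q, (i \o b), j, phi; split; [|split; [split; split|split]] => //.
  + move=> S x y; have [l [[l1 l2] Ul]] := HP S (b \o x) y.
    exists l; split; first by rewrite -comp_assoc l1 comp_assoc ab comp_idl.
    by move=> l' [E1 E2]; apply: Ul; split=> //; rewrite -E1 !comp_assoc ba comp_idl.
  + by rewrite -comp_assoc (precomp pi) comp_idl.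
  + by rewrite comp_assoc; apply: zero_map_precomp.
  + by rewrite -comp_assoc; apply: zero_map_postcomp.
  + by rewrite comp_assoc phi_i.
- move=> S t Ht; have [x [Hx Ux]] := Huniv S t Ht.
  exists (a \o x); split; first by rewrite comp_assoc Ea.
  by move=> y Hy; rewrite (Ux (b \o y)) comp_assoc ?Eb // ab comp_idl.
Qed.

(** Two centralizers of [v] are isomorphic over [T], so preservation can be tested
    on one of them. *)
Lemma preserves_centralizer_of_one (D D' : Category) (F : Functor D D') (U T Z Z' : D)
    (v : U ~> T) (zeta : Z ~> T) (zeta' : Z' ~> T) :
  is_centralizer v zeta -> is_centralizer (fmap F v) (fmap F zeta) ->
  is_centralizer v zeta' -> is_centralizer (fmap F v) (fmap F zeta').
Proof.
move=> [Hz Uz] HF [Hz' Uz'].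
have [a [Ea _]] := Uz' _ _ Hz; have [b [Eb _]] := Uz _ _ Hz'.
have ab : a \o b = idm Z'.
  have [c [_ Uc]] := Uz' _ _ Hz'.
  by rewrite -(Uc (a \o b)) ?(Uc (idm Z')) ?comp_idr // comp_assoc Ea.
have ba : b \o a = idm Z.
  have [c [_ Uc]] := Uz _ _ Hz.
  by rewrite -(Uc (b \o a)) ?(Uc (idm Z)) ?comp_idr // comp_assoc Eb.
apply: (is_centralizer_iso (a := fmap F a) (b := fmap F b)) HF.
- by rewrite -fmap_comp ab fmap_id.
- by rewrite -fmap_comp ba fmap_id.
- by rewrite -fmap_comp Ea.
Qed.

Lemma cartesian_id (C : Category) (Y : C) (A : Pt Y) :
  cartesian_over (idm Y) (idm (pt_dom A)).
Proof.
split; last by rewrite comp_idl comp_idr.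
split=> [|S a b]; first by rewrite comp_idl comp_idr.
rewrite comp_idl => E; exists a; split; first by rewrite comp_idl.
by move=> x [<- _]; rewrite comp_idl.
Qed.

Lemma cartesian_base_change (C : Category) (pb : has_pullbacks C) (Y' Y : C) (g : Y' ~> Y)
    (A : Pt Y) :
  @cartesian_over C Y' Y g (base_change pb g A) A (leg1 (pullback pb (pt_map A) g)).
Proof.
by split; [exact: pullbackP | case: (pb_pairE pb (base_change_sec_eq g A))].
Qed.

Lemma stable_centralizers_exist (C : Category) (Cpointed : pointed C)
    (Cproto : protomodular C) (Cnorm : has_normalizers C) (Y : C) (U T : Pt Y) (v : U ~> T) :
  exists (Z : Pt Y) (zeta : Z ~> T), is_centralizer v zeta /\
    forall (pb : has_pullbacks C) (Y' : C) (g : Y' ~> Y),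
      is_centralizer (fmap (base_change pb g) v) (fmap (base_change pb g) zeta).
Proof.
have [K [k Hk]] := kernels_exist Cpointed (fc_pullbacks (proto_fc Cproto)) (pt_map U).
have [N [R [n [d0 [d1 [pi [theta HN]]]]]]] := graph_normalizer_exists Cproto Cnorm v Hk.
have [sigma [pi_sigma theta_sigma sigma_k sigma_rel]] := normalizer_section Hk HN.
have pb := fc_pullbacks (proto_fc Cproto).
have [Z HZ] := pb _ _ _ pi (pt_sec U).
have [sqZ _] := HZ.
have [s [[s1 s2] _]] : exists! s, leg1 Z \o s = sigma \o pt_sec U /\ leg2 Z \o s = idm Y.
  by apply: (proj2 HZ); rewrite comp_assoc pi_sigma comp_idl comp_idr.
pose ZP : Pt Y := Build_PtOb s2.
have z_map : pt_map T \o (theta \o leg1 Z) = pt_map ZP.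
  by rewrite comp_assoc -(gn_map HN) -comp_assoc sqZ comp_assoc pt_split comp_idl.
have z_sec : (theta \o leg1 Z) \o pt_sec ZP = pt_sec T.
  by rewrite -comp_assoc s1 comp_assoc theta_sigma pt_hom_sec.
pose zeta : ZP ~> T := @Build_PtHom C Y ZP T _ z_map z_sec.
have main Y' (g : Y' ~> Y) U' T' Z' (v' : U' ~> T') (zeta' : Z' ~> T') cU cT cZ :
    cartesian_over g cU -> cartesian_over g cT -> @cartesian_over C Y' Y g Z' ZP cZ ->
    cT \o pt_hom v' = pt_hom v \o cU -> cT \o pt_hom zeta' = pt_hom zeta \o cZ ->
    is_centralizer v' zeta'.
  move=> HcU HcT HcZ Ev Ezeta; split=> [|A t].
    exact: (@centralizer_commutes C Cpointed Cproto Y U T v K k Hk N R n d0 d1 pi theta HN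
      sigma ZP (leg1 Z) zeta pi_sigma theta_sigma sigma_rel HZ s1 eq_refl
      Y' g U' T' Z' v' zeta' cU cT cZ).
  exact: (@centralizer_universal C Cpointed Cproto Y U T v K k Hk N R n d0 d1 pi theta HN
      sigma ZP (leg1 Z) zeta pi_sigma theta_sigma sigma_k sigma_rel HZ s1 eq_refl
      Y' g U' T' Z' v' zeta' cU cT cZ).
exists ZP, zeta; split.
  apply: (main _ (idm Y)); try exact: cartesian_id.
    by rewrite comp_idl comp_idr.
  by rewrite comp_idl comp_idr.
move=> pb' Y' g; apply: (main _ g); try exact: cartesian_base_change.
  exact: (proj1 (pb_pairE pb' (base_change_hom_eq pb' g v))).
exact: (proj1 (pb_pairE pb' (base_change_hom_eq pb' g zeta))).
Qed.

Theorem theorem4p7 (C : Category) (Cpointed : pointed C) (Cproto : protomodular C)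
    (Cnorm : has_normalizers C) : BC_facc C.
Proof.
have stable := stable_centralizers_exist Cpointed Cproto Cnorm.
have Hfacc : facc C.
  split; first exact: protomodular_maltsev.
  move=> Y; apply: acc_of_centralizers; first exact: pt_unital.
  by move=> U T v _; have [Z [zeta [Hz _]]] := stable Y U T v; exists Z, zeta.
exists Hfacc => Y' Y g U T Z v zeta _ Hz.
have [Z0 [zeta0 [Hz0 HF]]] := stable Y U T v.
exact: preserves_centralizer_of_one Hz0 (HF _ _ g) Hz.
Qed.
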